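(* Let $\mathcal{X}=\mathbb{R}^p$, let $\mathcal{Y}\subset\mathbb{R}^q$ be convex and compact with diameter $D_{\mathcal{Y}}=\max_{y,y'\in\mathcal{Y}}\|y-y'\|$, and let $g:\mathcal{X}\times\mathcal{Y}\to\mathbb{R}$ be $L$-smooth, with $g(\cdot,y)$ $\sigma$-strongly convex for every $y\in\mathcal{Y}$ and $g(x,\cdot)$ concave for every $x\in\mathcal{X}$, where $0<\sigma\le L$. Let $K\ge 1$ and let $\varepsilon^{(1)}_{\rm step},\dots,\varepsilon^{(K)}_{\rm step}>0$. Then after $K$ iterations the algorithm DIAG (described in the context), run with these tolerances from any $x_0\in\mathcal{X}$, $y_0\in\mathcal{Y}$, finds $(\bar x_K,y_K)$ such that $$\max_{\tilde y\in\mathcal{Y}} g(\bar x_K,\tilde y)-\min_{\tilde x\in\mathcal{X}} g(\tilde x,y_K)\;\le\;\frac{4\frac{L^2}{\sigma}D_{\mathcal{Y}}^2+\sum_{k=1}^K k(k+1)\,\varepsilon^{(k)}_{\rm step}}{K(K+1)}.$$ In particular, setting $\varepsilon^{(k)}_{\rm step}=\frac{L^2D_{\mathcal{Y}}^2}{\sigma k^3(k+1)}$ (with $D_{\mathcal{Y}}>0$), one has $$\max_{\tilde y\in\mathcal{Y}} g(\bar x_K,\tilde y)-\min_{\tilde x\in\mathcal{X}} g(\tilde x,y_K)\;\le\;\frac{6\frac{L^2}{\sigma}D_{\mathcal{Y}}^2}{K(K+1)}.$$ Furthermore, for this setting of the tolerances the total first-order oracle complexity (total number of gradient evaluations of $g$)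 is $O\big(\sqrt{L/\sigma}\;K\log^2 K\big)$.
   Context: Norms are Euclidean; $\mathcal{P}_{\mathcal{Y}}$ denotes Euclidean projection onto $\mathcal{Y}$. A differentiable function $g(x,y)$ is $L$-smooth if for all $(x,y),(x',y')$, $$\max\{\|\nabla_x g(x,y)-\nabla_x g(x',y')\|,\ \|\nabla_y g(x,y)-\nabla_y g(x',y')\|\}\le L(\|x-x'\|+\|y-y'\|).$$ Big-$O$: $T(K)=O(S(K))$ means $\limsup_{K\to\infty}T(K)/S(K)<\infty$, the problem data ($g$, $\mathcal{Y}$, starting points) being fixed. **Algorithm DIAG** (Dual Implicit Accelerated Gradient). Input: $g,L,\sigma,x_0,y_0,K,\{\varepsilon^{(k)}_{\rm step}\}_{k=1}^K$. Set $\beta=2L^2/\sigma$, $z_0=y_0$. For $k=0,1,\dots,K-1$: - $\tau_k=\frac{2}{k+2}$, $\eta_k=\frac{k+1}{2\beta}$, $w_k=(1-\tau_k)y_k+\tau_k z_k$; - $(x_{k+1},y_{k+1})=\text{Imp-STEP}(g,L,\sigma,x_0,w_k,\beta,\varepsilon^{(k+1)}_{\rm step})$, intended to ensure $g(x_{k+1},y_{k+1})\le\min_x g(x,y_{k+1})+\varepsilon^{(k+1)}_{\rm step}$ and $y_{k+1}=\mathcal{P}_{\mathcal{Y}}\big(w_k+\frac1\beta\nabla_y g(x_{k+1},w_k)\big)$; - $z_{k+1}=\mathcal{P}_{\mathcal{Y}}\big(z_k+\eta_k\nabla_y g(x_{k+1},w_k)\big)$, $\ \bar x_{k+1}=\frac{2}{(k+1)(k+2)}\sum_{i=1}^{k+1}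 i\,x_i$. Return $(\bar x_K,y_K)$. **Subroutine Imp-STEP**$(g,L,\sigma,x_0,w,\beta,\varepsilon_{\rm step})$. Set $\varepsilon_{\rm mp}=\frac{2\sigma}{5L}\sqrt{\frac{2\varepsilon_{\rm step}}{L}}$, $R=\lceil\log_2\frac{2D_{\mathcal{Y}}}{\varepsilon_{\rm mp}}\rceil$ (the routine is understood for $R\ge 0$), $\varepsilon_{\rm agd}=\frac{\sigma\beta^2\varepsilon_{\rm mp}^2}{32L^2}$, and (locally) $y_0=w$. For $r=0,1,\dots,R$: starting at $x_0$, use Nesterov's accelerated gradient descent for the $L$-smooth, $\sigma$-strongly convex function $g(\cdot,y_r)$ to compute $\hat x_r$ with $g(\hat x_r,y_r)\le\min_x g(x,y_r)+\varepsilon_{\rm agd}$; then set $y_{r+1}=\mathcal{P}_{\mathcal{Y}}\big(w+\frac1\beta\nabla_y g(\hat x_r,w)\big)$. Return $(\hat x_R,y_{R+1})$. *)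

(* Defs.v *)
From HB Require Import structures.
From mathcomp Require Import all_boot all_order all_algebra.
From mathcomp Require Import all_classical all_reals all_analysis.

Set Implicit Arguments.
Unset Strict Implicit.
Unset Printing Implicit Defensive.

Import Order.TTheory GRing.Theory Num.Theory.
Import numFieldNormedType.Exports.

Local Open Scope classical_set_scope.
Local Open Scope ring_scope.

(* The library norm on 'rV[R]_n is the sup norm, hence dot and enorm for the
   Euclidean structure; the topology on 'rV[R]_n is the same for both. *)
Definition dot {R : realType} {n : nat} (u v : 'rV[R]_n) : R :=
  \sum_(i < n) u 0 i * v 0 i.

Definition enorm {R : realType} {n : nat} (u : 'rV[R]_n) : R :=
  Num.sqrt (dot u u).

Definition is_max {R : realType} (S : set R) (m : R) : Prop :=
  S m /\ ubound S m.

Definition is_min {R : realType} (S : set R) (m : R) : Prop :=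
  S m /\ lbound S m.

(* The default 0 is irrelevant when Y is nonempty, closed and convex. *)
Definition proj {R : realType} {n : nat} (Y : set 'rV[R]_n) (v : 'rV[R]_n) :
    'rV[R]_n :=
  xget 0 [set u | Y u /\ forall u', Y u' -> enorm (v - u) <= enorm (v - u')].

(* (gx, gy) is the gradient of g on R^p x Y. The first-order expansion is only
   required along R^p x Y, so g need not be differentiable (nor meaningful)
   outside of it. If Y has empty interior, gy is one choice among several, for
   instance the gradient of a differentiable extension of g. *)
Definition gradient_on {R : realType} {p q : nat} (Y : set 'rV[R]_q)
    (g : 'rV[R]_p -> 'rV[R]_q -> R)
    (gx : 'rV[R]_p -> 'rV[R]_q -> 'rV[R]_p)
    (gy : 'rV[R]_p -> 'rV[R]_q -> 'rV[R]_q) : Prop :=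
  forall x y, Y y -> forall e : R, 0 < e ->
    \forall z \near within (setT `*` Y) (nbhs (x, y)),
      `|g z.1 z.2 - g x y - dot (gx x y) (z.1 - x) - dot (gy x y) (z.2 - y)|
      <= e * (enorm (z.1 - x) + enorm (z.2 - y)).

Definition smooth_on {R : realType} {p q : nat} (Y : set 'rV[R]_q) (L : R)
    (g : 'rV[R]_p -> 'rV[R]_q -> R)
    (gx : 'rV[R]_p -> 'rV[R]_q -> 'rV[R]_p)
    (gy : 'rV[R]_p -> 'rV[R]_q -> 'rV[R]_q) : Prop :=
  gradient_on Y g gx gy /\
  forall x y x' y', Y y -> Y y' ->
    Num.max (enorm (gx x y - gx x' y')) (enorm (gy x y - gy x' y'))
    <= L * (enorm (x - x') + enorm (y - y')).

Definition strongly_convex {R : realType} {n : nat} (sigma : R)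
    (f : 'rV[R]_n -> R) : Prop :=
  forall (x x' : 'rV[R]_n) (t : R), 0 <= t -> t <= 1 ->
    f (t *: x + (1 - t) *: x') <=
      t * f x + (1 - t) * f x'
      - sigma / 2 * (t * (1 - t)) * enorm (x - x') ^+ 2.

Definition concave_on {R : realType} {n : nat} (Y : set 'rV[R]_n)
    (f : 'rV[R]_n -> R) : Prop :=
  convex_function Y (fun y => - f y : R^o).

(* x minimizes f up to an additive error e *)
Definition near_min {R : realType} {n : nat} (f : 'rV[R]_n -> R) (e : R)
    (x : 'rV[R]_n) : Prop :=
  exists m, is_min (range f) m /\ f x <= m + e.

(* max_(y' in Y) g x y' - min_x' g x' y <= b, both extrema being attained *)
Definition gap_le {R : realType} {p q : nat} (Y : set 'rV[R]_q)
    (g : 'rV[R]_p -> 'rV[R]_q -> R) (x : 'rV[R]_p) (y : 'rV[R]_q) (b : R) :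
    Prop :=
  exists M m, [/\ is_max [set g x y' | y' in Y] M,
                  is_min (range (g^~ y)) m & M - m <= b].

Section AGD.
Context {R : realType} {n : nat} (f : 'rV[R]_n -> R)
  (df : 'rV[R]_n -> 'rV[R]_n) (L sigma : R) (x0 : 'rV[R]_n).

(* Nesterov's method with constant momentum for L-smooth sigma-strongly convex
   objectives: the pair (iterate, extrapolated point) after t steps. Each step
   makes exactly one gradient evaluation, at the extrapolated point. *)
Fixpoint agd_state (t : nat) : 'rV[R]_n * 'rV[R]_n :=
  if t is t'.+1 then
    let: (x, v) := agd_state t' in
    let x' := v - L^-1 *: df v in
    let theta := (Num.sqrt L - Num.sqrt sigma) /
                 (Num.sqrt L + Num.sqrt sigma) in
    (x', x' + theta *: (x' - x))
  else (x0, x0).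

Definition agd (t : nat) : 'rV[R]_n := (agd_state t).1.

Definition agd_reaches (e : R) (t : nat) : Prop := near_min f e (agd t).

Definition agd_first_reaches (e : R) (t : nat) : Prop :=
  agd_reaches e t /\ forall s, (s < t)%N -> ~ agd_reaches e s.

End AGD.

Section Algorithm.
Context {R : realType} {p q : nat}
  (g : 'rV[R]_p -> 'rV[R]_q -> R)
  (gx : 'rV[R]_p -> 'rV[R]_q -> 'rV[R]_p)
  (gy : 'rV[R]_p -> 'rV[R]_q -> 'rV[R]_q)
  (Y : set 'rV[R]_q) (D L sigma : R) (x0 : 'rV[R]_p).

Definition eps_mp (eps_step : R) : R :=
  2 * sigma / (5 * L) * Num.sqrt (2 * eps_step / L).

(* ceil (log_2 (2 D / eps_mp)), truncated below at 0; it is also 0 when D = 0,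
   because ln 0 = 0. *)
Definition imp_rounds (eps_step : R) : nat :=
  `|Num.max (0 : int) (Num.ceil (ln (2 * D / eps_mp eps_step) / ln 2))|%N.

Definition eps_agd (beta eps_step : R) : R :=
  sigma * beta ^+ 2 * eps_mp eps_step ^+ 2 / (32 * L ^+ 2).

(* In the subroutine, T r is the number of steps of the r-th call to AGD. *)
Section ImpStep.
Context (w : 'rV[R]_q) (beta : R) (T : nat -> nat).

Fixpoint imp_y (r : nat) : 'rV[R]_q :=
  if r is r'.+1 then
    proj Y (w + beta^-1 *:
              gy (agd (gx^~ (imp_y r')) L sigma x0 (T r')) w)
  else w.

Definition imp_x (r : nat) : 'rV[R]_p :=
  agd (gx^~ (imp_y r)) L sigma x0 (T r).

Definition imp_step (eps_step : R) : 'rV[R]_p * 'rV[R]_q :=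
  (imp_x (imp_rounds eps_step), imp_y (imp_rounds eps_step).+1).

End ImpStep.

(* In the outer loop, T k r is the number of steps of the r-th call to AGD
   during iteration k; the tolerances are eps 1, eps 2, and so on. *)
Context (y0 : 'rV[R]_q) (eps : nat -> R) (T : nat -> nat -> nat).

Definition diag_beta : R := 2 * L ^+ 2 / sigma.
Definition diag_tau (k : nat) : R := 2 / k.+2%:R.
Definition diag_eta (k : nat) : R := k.+1%:R / (2 * diag_beta).

Record diag_point := DiagPoint
  { pt_x : 'rV[R]_p; pt_y : 'rV[R]_q; pt_z : 'rV[R]_q }.

Definition mix (k : nat) (s : diag_point) : 'rV[R]_q :=
  (1 - diag_tau k) *: pt_y s + diag_tau k *: pt_z s.

Fixpoint diag_state (k : nat) : diag_point :=
  if k is k'.+1 then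
    let s := diag_state k' in
    let w := mix k' s in
    let: (x, y) := imp_step w diag_beta (T k') (eps k'.+1) in
    DiagPoint x y (proj Y (pt_z s + diag_eta k' *: gy x w))
  else DiagPoint x0 y0 y0.

Definition diag_w (k : nat) : 'rV[R]_q := mix k (diag_state k).

Definition diag_y (K : nat) : 'rV[R]_q := pt_y (diag_state K).

Definition diag_xbar (K : nat) : 'rV[R]_p :=
  (2 / (K%:R * K.+1%:R)) *:
    \sum_(1 <= i < K.+1) i%:R *: pt_x (diag_state i).

(* stop f df e t: a call to AGD on f (with gradient df) and target accuracy e
   may be stopped after t steps *)
Definition diag_calls
    (stop : ('rV[R]_p -> R) -> ('rV[R]_p -> 'rV[R]_p) -> R -> nat -> Prop)
    (K : nat) : Prop :=
  forall k r, (k < K)%N -> (r <= imp_rounds (eps k.+1))%N ->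
    let y := imp_y (diag_w k) diag_beta (T k) r in
    stop (g^~ y) (gx^~ y) (eps_agd diag_beta (eps k.+1)) (T k r).

(* T describes a run of K iterations: every call to AGD meets its accuracy. *)
Definition diag_run (K : nat) : Prop :=
  diag_calls (fun f df => agd_reaches f df L sigma x0) K.

(* Moreover, every call to AGD stops as soon as its accuracy is met. *)
Definition diag_first_run (K : nat) : Prop :=
  diag_calls (fun f df => agd_first_reaches f df L sigma x0) K.

(* T k r evaluations of gx for each call to AGD, one evaluation of gy for each
   inner update and one for the update of z *)
Definition diag_oracle_calls (K : nat) : nat :=
  (\sum_(k < K) (\sum_(r < (imp_rounds (eps k.+1)).+1) (T k r + 1) + 1))%N.

End Algorithm.

(* Main.v *)
Require Import Defs.
From HB Require Import structures.
From mathcomp Require Import all_boot all_order all_algebra.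
From mathcomp Require Import all_classical all_reals all_analysis.
From mathcomp Require Import ring lra.

Set Implicit Arguments.
Unset Strict Implicit.
Unset Printing Implicit Defensive.

Import Order.TTheory GRing.Theory Num.Theory.
Import numFieldNormedType.Exports.

Local Open Scope classical_set_scope.
Local Open Scope ring_scope.

(* The gap.  Write h(y) = min_x g(x, y).  If x minimizes g(., y') up to e, where
   y' is the implicit step from w, then concavity of g(x, .) gives, for
   every competitor u in Y, a linear upper model of g(x, u) at w and a quadratic
   lower model of g(x, y') at w with the same gradient.  Since y' and the new z
   are projected gradient steps for that gradient, the usual estimate for
   accelerated ascent yields
     (k+1)(k+2) (h(y_(k+1)) + e) >= k(k+1) h(y_k) + 2(k+1) g(x_(k+1), u)
                         - 2 beta (|u - z_k|^2 - |u - z_(k+1)|^2),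
   which telescopes; Jensen's inequality for the weights k turns the sum of the
   g(x_k, u) into g(xbar, u).  Smoothness of h is never needed.

   The inner loop.  The argmin of g(., y) is L/sigma-Lipschitz in y, so with
   beta = 2 L^2 / sigma the inner iteration is a 1/2-contraction up to an error
   controlled by eps_agd, and successive inner iterates satisfy
   |y_(r+1) - y_r| <= D / 2^r + eps_mp.

   Complexity.  AGD decreases f(x) - f* + sigma/2 |z - x*|^2 by the factor
   1 - sqrt (sigma / L) per step.  For the prescribed tolerances both the
   number of inner rounds and the length of each call to AGD are O(log K),
   uniformly in y because |gx x0 y| is bounded on Y. *)

(** * Euclidean geometry and first-order inequalities *)

Section Euclid.
Context {R : realType} {n : nat}.
Implicit Types (u v w : 'rV[R]_n) (a : R).

Lemma dotC u v : dot u v = dot v u.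
Proof. by apply: eq_bigr => i _; rewrite mulrC. Qed.

Lemma dotDl u v w : dot (u + v) w = dot u w + dot v w.
Proof. by rewrite -big_split; apply: eq_bigr => i _; rewrite mxE mulrDl. Qed.

Lemma dotZl a u v : dot (a *: u) v = a * dot u v.
Proof. by rewrite mulr_sumr; apply: eq_bigr => i _; rewrite mxE mulrA. Qed.

Lemma dotNl u v : dot (- u) v = - dot u v.
Proof. by rewrite -scaleN1r dotZl mulN1r. Qed.

Lemma dotDr u v w : dot u (v + w) = dot u v + dot u w.
Proof. by rewrite dotC dotDl (dotC v) (dotC w). Qed.

Lemma dotZr a u v : dot u (a *: v) = a * dot u v.
Proof. by rewrite dotC dotZl dotC. Qed.

Lemma dotNr u v : dot u (- v) = - dot u v.
Proof. by rewrite dotC dotNl dotC. Qed.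

Definition dotE := (dotDl, dotDr, dotNl, dotNr, dotZl, dotZr).

Lemma dot_ge0 u : 0 <= dot u u.
Proof. by apply: sumr_ge0 => i _; rewrite -expr2 sqr_ge0. Qed.

Lemma enorm_ge0 u : 0 <= enorm u.
Proof. exact: sqrtr_ge0. Qed.

Lemma enorm2 u : enorm u ^+ 2 = dot u u.
Proof. by rewrite sqr_sqrtr // dot_ge0. Qed.

Lemma enorm0 : enorm (0 : 'rV[R]_n) = 0.
Proof. by rewrite /enorm -(scale0r 0) dotZl mul0r sqrtr0. Qed.

Lemma ler_coord_enorm u i : `|u 0 i| <= enorm u.
Proof.
rewrite -(ler_pXn2r (_ : 0 < 2)%N) ?nnegrE ?enorm_ge0 //.
rewrite enorm2 real_normK ?num_real // /dot (bigD1 i) //= -expr2 lerDl.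
by apply: sumr_ge0 => j _; rewrite -expr2 sqr_ge0.
Qed.

Lemma enorm_eq0 u : enorm u = 0 -> u = 0.
Proof.
move=> u0; apply/rowP => i; rewrite mxE; apply/eqP.
by rewrite -normr_le0 -u0 ler_coord_enorm.
Qed.

Lemma enorm_gt0 u : u != 0 -> 0 < enorm u.
Proof.
move=> u0; rewrite lt_neqAle enorm_ge0 andbT eq_sym.
by apply: contra_neq u0; exact: enorm_eq0.
Qed.

Lemma enormZ a u : enorm (a *: u) = `|a| * enorm u.
Proof. by rewrite /enorm !dotE mulrA -expr2 sqrtrM ?sqr_ge0 // sqrtr_sqr. Qed.

Lemma enormN u : enorm (- u) = enorm u.
Proof. by rewrite -scaleN1r enormZ normrN1 mul1r. Qed.

Lemma enormB u v : enorm (u - v) = enorm (v - u).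
Proof. by rewrite -enormN opprB. Qed.

(** Cauchy-Schwarz: expand the square of |v| u - |u| v and divide by |u| |v|. *)
Lemma dot_le u v : dot u v <= enorm u * enorm v.
Proof.
have [->|u0] := eqVneq u 0.
  by rewrite -(scale0r 0) dotZl mul0r mulr_ge0 ?enorm_ge0.
have [->|v0] := eqVneq v 0.
  by rewrite -(scale0r 0) dotZr mul0r mulr_ge0 ?enorm_ge0.
have := dot_ge0 (enorm v *: u - enorm u *: v).
rewrite !dotE (dotC v u) -!enorm2.
have := enorm_gt0 u0; have := enorm_gt0 v0.
set a := enorm u; set b := enorm v => b0 a0 h.
have ab0 : 0 < a * b by rewrite mulr_gt0.
by rewrite -(ler_pM2l ab0); lra.
Qed.

Lemma dot_norm_le u v : `|dot u v| <= enorm u * enorm v.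
Proof.
by rewrite ler_norml dot_le andbT lerNl -dotNl (le_trans (dot_le _ _)) ?enormN.
Qed.

Lemma enormD u v : enorm (u + v) <= enorm u + enorm v.
Proof.
rewrite -(ler_pXn2r (_ : 0 < 2)%N) ?nnegrE ?addr_ge0 ?enorm_ge0 //.
have := dot_le u v.
by rewrite enorm2 !dotE (dotC v u) sqrrD !enorm2; lra.
Qed.

Lemma enormBD w u v : enorm (u - v) <= enorm (u - w) + enorm (w - v).
Proof. by have := enormD (u - w) (w - v); rewrite addrA subrK. Qed.

(** One half of the comparison between the sup-norm topology and the Euclidean norm: n coordinates
    below d / (n + 1) give Euclidean length below d, also for n = 0. *)
Lemma near_enorm_lt u (d : R) : 0 < d -> \forall v \near u, enorm (v - u) < d.
Proof.
move=> d0; pose c : R := n.+1%:R.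
have c0 : 0 < c by rewrite ltr0n.
apply/nbhs_ballP; exists (d / c); first by rewrite /= divr_gt0.
move=> v [_ /(_ 0)] uv.
rewrite -(ltr_pXn2r (_ : 0 < 2)%N) ?nnegrE ?enorm_ge0 ?(ltW d0) // enorm2.
have h i : (v - u) 0 i * (v - u) 0 i <= (d / c) ^+ 2.
  rewrite -expr2 -real_normK ?num_real //.
  have dc0 : 0 <= d / c by rewrite ltW // divr_gt0.
  rewrite ler_pXn2r ?nnegrE // !mxE distrC ltW //.
  exact: uv.
apply: (@le_lt_trans _ _ (\sum_(i < n) (d / c) ^+ 2)).
  by apply: ler_sum => i _; exact: h.
rewrite sumr_const card_ord -mulr_natr expr_div_n -mulrA gtr_pMr ?exprn_gt0 //.
rewrite mulrC ltr_pdivrMr ?exprn_gt0 // mul1r /c -natrX ltr_nat.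
by rewrite expnS expn1 (leq_trans (ltnSn _)) // leq_pmulr.
Qed.

Lemma nbhs_enorm u (A : set 'rV[R]_n) : nbhs u A ->
  exists2 d : R, 0 < d & forall v, enorm (v - u) < d -> A v.
Proof.
move=> /nbhs_ballP[d /= d0 dA]; exists d => // v vd; apply: dA; split=> // i j.
rewrite (ord1 i) /ball /= distrC (le_lt_trans _ vd) //.
by have := ler_coord_enorm (v - u) j; rewrite !mxE.
Qed.

Definition econtinuous_on (A : set 'rV[R]_n) (f : 'rV[R]_n -> R) : Prop :=
  forall u, A u -> forall e : R, 0 < e -> exists2 d : R, 0 < d &
    forall v, A v -> enorm (v - u) < d -> `|f v - f u| < e.

Lemma compact_min (A : set 'rV[R]_n) (f : 'rV[R]_n -> R) :
  A !=set0 -> compact A -> econtinuous_on A f ->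
  exists2 c, A c & forall t, A t -> f c <= f t.
Proof.
move=> A0 cA cf.

have [|c] := @compact_EVT_min _ _ f A A0 cA.
  apply/subspace_continuousP => u Au; apply/cvgrPdist_lt => e e0.
  have [d d0 fd] := cf u Au e e0.
  apply: filterS (near_enorm_lt u d0) => v vd Av.
  by rewrite distrC fd.
rewrite inE => Ac cmin; exists c => // t At; apply: cmin.
by rewrite inE.
Qed.

Definition has_gradient_on (C : set 'rV[R]_n) (f : 'rV[R]_n -> R)
    (df : 'rV[R]_n -> 'rV[R]_n) : Prop :=
  forall u, C u -> forall e : R, 0 < e -> exists2 d : R, 0 < d &
    forall v, C v -> enorm (v - u) < d ->
      `|f v - f u - dot (df u) (v - u)| <= e * enorm (v - u).

Lemma has_gradient_continuous C f df :
  has_gradient_on C f df -> econtinuous_on C f.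
Proof.
move=> hf u Cu e e0; have [d d0 hd] := hf u Cu 1 ltr01.
pose c := enorm (df u) + 1.
have c0 : 0 < c by rewrite ltr_wpDl ?enorm_ge0.
exists (Num.min d (e / c)); first by rewrite lt_min d0 divr_gt0.
move=> v Cv; rewrite lt_min ltr_pdivlMr // => /andP[vd ve].
apply: le_lt_trans ve; rewrite /c mulrDr.
have := hd v Cv vd; have := dot_norm_le (df u) (v - u).
rewrite !ler_norml; lra.
Qed.

Definition segment_closed (C : set 'rV[R]_n) : Prop :=
  forall u v (t : R), C u -> C v -> 0 <= t <= 1 -> C (t *: u + (1 - t) *: v).

Definition sconvex_on (C : set 'rV[R]_n) (mu : R) (f : 'rV[R]_n -> R) : Prop :=
  forall u v (t : R), C u -> C v -> 0 <= t <= 1 ->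
    f (t *: u + (1 - t) *: v) <=
      t * f u + (1 - t) * f v - mu / 2 * (t * (1 - t)) * enorm (u - v) ^+ 2.

Definition grad_lower (C : set 'rV[R]_n) (mu : R) (f : 'rV[R]_n -> R)
    (df : 'rV[R]_n -> 'rV[R]_n) : Prop :=
  forall u v, C u -> C v ->
    f u + dot (df u) (v - u) + mu / 2 * enorm (v - u) ^+ 2 <= f v.

(** Expand [f] at [u] in the direction of [v], compare with the chord and divide by [t]; an explicit
    small [t] replaces the limit. *)
Lemma sconvex_grad_lower C mu f df : 0 <= mu -> segment_closed C ->
  has_gradient_on C f df -> sconvex_on C mu f -> grad_lower C mu f df.
Proof.
move=> mu0 sC hf cf u v Cu Cv.
set N := enorm (v - u); have N0 : 0 <= N := enorm_ge0 _.
have h2 : 0 <= mu / 2 * N ^+ 2 by rewrite mulr_ge0 ?divr_ge0 ?sqr_ge0.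
set c := N + mu / 2 * N ^+ 2.
have c0 : 0 <= c by rewrite addr_ge0.
apply/ler_addgt0Pr => e e0.
have c1 : 0 < c + 1 by rewrite ltr_wpDl.
(* The expansion costs e' N, and the factor 1 - t on the quadratic term costs t mu N^2 / 2. Since t
   <= e', the total is at most e' c <= e. *)
pose e' := e / (c + 1); have e'0 : 0 < e' by rewrite divr_gt0.
have [d d0 hd] := hf u Cu e' e'0.
have N1 : 0 < N + 1 by rewrite ltr_wpDl.
pose t := Num.min (d / (N + 1)) (Num.min e' 1).
have t0 : 0 < t by rewrite !lt_min divr_gt0 //= e'0 ltr01.
have t1 : t <= 1 by rewrite !ge_min lexx !orbT.
have te : t <= e' by rewrite !ge_min lexx !orbT.
have td : t * (N + 1) <= d by rewrite -ler_pdivlMr // ge_min lexx.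
have tI : 0 <= t <= 1 by rewrite ltW.
have E : t *: v + (1 - t) *: u - u = t *: (v - u).
  by rewrite scalerBl scale1r scalerBr addrCA addrAC subrr add0r.
have := cf v u t Cv Cu tI; rewrite -/N.
have := hd _ (sC v u t Cv Cu tI); rewrite E enormZ (gtr0_norm t0) -/N dotZr.
have tN : t * N < d by apply: lt_le_trans td; rewrite ltr_pM2l // ltrDl.
move=> /(_ tN); rewrite ler_norml => /andP[h1 _] h3.
have h4 : t * dot (df u) (v - u) - e' * (t * N) <=
   t * (f v - f u) - mu / 2 * (t * (1 - t)) * N ^+ 2 by lra.
have h5 : dot (df u) (v - u) - e' * N <= f v - f u - mu / 2 * (1 - t) * N ^+ 2.
  by rewrite -(ler_pM2l t0); lra.
have h6 : t * (mu / 2 * N ^+ 2) <= e' * (mu / 2 * N ^+ 2) by rewrite ler_wpM2r.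
have h7 : e' * c <= e.
  by rewrite /e' -mulrA ger_pMr // mulrC ler_pdivrMr // mul1r lerDl.
rewrite /c in h7; lra.
Qed.

(* Splitting [u, v] into N equal pieces and using the gradient inequality at the
   right end of each one gives the bound up to a factor 1 + 1/N; convexity thus
   replaces the usual integration along the segment. *)
Lemma gradient_step_bound C f df L :
  0 <= L -> segment_closed C -> grad_lower C 0 f df ->
  (forall u v, C u -> C v -> enorm (df u - df v) <= L * enorm (u - v)) ->
  forall u v, C u -> C v ->
    f v <= f u + dot (df u) (v - u) + L / 2 * enorm (v - u) ^+ 2.
Proof.
move=> L0 sC gf lf u v Cu Cv.
set N := enorm (v - u); have N0 : 0 <= N := enorm_ge0 _.
suff H (m : nat) : f v <= f u + dot (df u) (v - u)
    + L / 2 * N ^+ 2 * (1 + m.+1%:R^-1).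
  apply/ler_addgt0Pr => e e0; pose c := L / 2 * N ^+ 2 / e.
  have [m cm] : exists m : nat, c < m.+1%:R.
    by exists (Num.trunc c); exact: truncnS_gt.
  apply: le_trans (H m) _.
  have : L / 2 * N ^+ 2 / m.+1%:R <= e.
    rewrite ler_pdivrMr ?ltr0n // [leRHS]mulrC.
    by move: cm; rewrite /c ltr_pdivrMr // => /ltW.
  by rewrite mulrDr mulr1 addrA lerD2l.
pose h : R := m.+1%:R^-1.
have h0 : 0 < h by rewrite invr_gt0 ltr0n.
pose w (i : nat) := (i%:R * h) *: v + (1 - i%:R * h) *: u.
have Cw i : (i <= m.+1)%N -> C (w i).
  move=> im; apply: sC => //; rewrite mulr_ge0 ?ler0n ?(ltW h0) //=.
  by rewrite /h ler_pdivrMr ?ltr0n // mul1r ler_nat.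
have wB i : w i - u = (i%:R * h) *: (v - u).
  by rewrite /w scalerBl scale1r scalerBr addrCA addrAC subrr add0r.
have wS i : w i - w i.+1 = - (h *: (v - u)).
  rewrite -(subrK u (w i)) -[w i.+1](subrK u) opprD addrACA subrr addr0 !wB.
  rewrite -scalerBl -[RHS]scaleNr -[i.+1%:R]natr1.
  by congr (_ *: _); ring.
(* Along v - u, the slope at [w j] exceeds the slope at [u] by at most L j h N^2; summing over j <=
   i produces i (i + 1) / 2. *)
have step i : (i <= m.+1)%N -> f (w i) <= f u + i%:R * h * dot (df u) (v - u)
    + L * N ^+ 2 * h ^+ 2 * (i%:R * i.+1%:R / 2).
  elim: i => [|i IH] im.
    by rewrite /w !mul0r scale0r subr0 scale1r add0r mulr0 !addr0.
  have := IH (ltnW im); have := gf _ _ (Cw _ im) (Cw _ (ltnW im)).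
  rewrite wS dotNr dotZr mul0r mul0r addr0.
  have := dot_le (df (w i.+1) - df u) (v - u).
  rewrite !dotE -/N.
  have := lf _ _ (Cw _ im) Cu; rewrite wB enormZ -/N ger0_norm; last first.
    by rewrite mulr_ge0 ?ler0n ?(ltW h0).
  set X := enorm (_ - _) => hX hd h1 h2.
  have hX2 : h * (X * N) <= h * (L * (i.+1%:R * h * N) * N).
    by rewrite ler_wpM2l ?(ltW h0) // ler_wpM2r.
  have hd2 := ler_wpM2l (ltW h0) hd.
  move: h1 h2 hX2 hd2; rewrite -[i.+2%:R]natr1 -[i.+1%:R]natr1.
  by move: (i%:R) => I; lra.
have := step m.+1 (leqnn _).
have hm : m.+1%:R * h = 1 by rewrite mulfV // pnatr_eq0.
rewrite /w hm subrr scale0r scale1r addr0 mul1r -/h.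
suff -> : L * N ^+ 2 * h ^+ 2 * (m.+1%:R * m.+2%:R / 2) =
  L / 2 * N ^+ 2 * (1 + h) by [].
have -> : m.+2%:R = m.+1%:R + 1 :> R by rewrite natr1.
transitivity (L / 2 * N ^+ 2 * ((m.+1%:R * h) * (m.+1%:R * h + h))); first by ring.
by rewrite hm mul1r.
Qed.

End Euclid.

(** * Accelerated gradient descent *)

Section SmoothStronglyConvex.
Context {R : realType} {n : nat}.
Implicit Types (f : 'rV[R]_n -> R) (df : 'rV[R]_n -> 'rV[R]_n) (u v : 'rV[R]_n).

Definition quad_upper (L : R) f df : Prop :=
  forall u v, f v <= f u + dot (df u) (v - u) + L / 2 * enorm (v - u) ^+ 2.

(** A minimum over the box of half-width [r] is global: once |v| >= r, the quadratic term of the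
    lower bound at 0 outweighs the linear one, so f v >= f 0. *)
Lemma sconvex_argmin sigma f df : 0 < sigma ->
  has_gradient_on setT f df -> grad_lower setT sigma f df ->
  exists x, forall v, f x <= f v.
Proof.
move=> s0 hf gf; pose r := 2 * enorm (df 0) / sigma.
have r0 : 0 <= r by rewrite divr_ge0 ?mulr_ge0 ?enorm_ge0 ?(ltW s0).
pose A := [set v : 'rV[R]_n | forall i, `[- r, r]%classic (v ord0 i)].
have cA : compact A.
  apply: (@rV_compact _ _ (fun=> `[- r, r]%classic)) => _.
  exact: segment_compact.
have A0 : A 0 by move=> i; rewrite mxE /= in_itv /= oppr_le0 r0.
have [|c Ac cmin] := @compact_min _ _ A f (ex_intro _ _ A0) cA.
  move=> u Au e e0; have [d d0 hd] := has_gradient_continuous hf (I : setT u) e0.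
  by exists d => // v _; exact: hd.
exists c => v; have [/cmin//|/existsNP[i vi]] := pselect (A v).
apply: le_trans (cmin _ A0) _.
have rv : r <= enorm v.
  apply: le_trans (ler_coord_enorm v i); rewrite leNgt; apply/negP => h.
  apply: vi; move: h; rewrite /= in_itv /= ltr_norml => /andP[h1 h2].
  by rewrite !ltW.
have := gf 0 v I I; have := dot_norm_le (df 0) v; rewrite subr0.
rewrite ler_norml => /andP[h1 _] h2.
suff : enorm (df 0) * enorm v <= sigma / 2 * enorm v ^+ 2 by lra.
rewrite expr2 mulrA ler_wpM2r ?enorm_ge0 //.
by move: rv; rewrite /r ler_pdivrMr // => rv; lra.
Qed.

Section Minimizer.
Context (f : 'rV[R]_n -> R) (df : 'rV[R]_n -> 'rV[R]_n) (L sigma : R).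
Context (s0 : 0 < sigma) (sL : sigma <= L).
Context (gl : grad_lower setT sigma f df) (qu : quad_upper L f df).
Context (xs : 'rV[R]_n) (xsmin : forall v, f xs <= f v).

Let L0 : 0 < L := lt_le_trans s0 sL.

(** A gradient step of size 1/L from [xs] would lower [f] by at least |df xs|^2 / (2 L). *)
Lemma gradient_argmin : df xs = 0.
Proof.
apply: enorm_eq0; apply/eqP; rewrite -sqrf_eq0.
rewrite eq_le sqr_ge0 andbT.
have := le_trans (xsmin _) (qu xs (xs - L^-1 *: df xs)).
rewrite [xs - _ - xs]addrAC subrr add0r enormN enormZ dotNr dotZr -enorm2 exprMn.
rewrite real_normK ?num_real //.
have -> : L / 2 * (L^-1 ^+ 2 * enorm (df xs) ^+ 2) =
  L^-1 * enorm (df xs) ^+ 2 / 2 by field; rewrite gt_eqF.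
have i0 : 0 < L^-1 by rewrite invr_gt0.
by move=> h; rewrite -(ler_pM2l i0) mulr0; lra.
Qed.

Lemma argmin_growth v : f xs + sigma / 2 * enorm (v - xs) ^+ 2 <= f v.
Proof.
have := gl (I : setT xs) (I : setT v).
by rewrite gradient_argmin -(scale0r 0) dotZl mul0r addr0.
Qed.

Lemma argmin_quad_upper v : f v <= f xs + L / 2 * enorm (v - xs) ^+ 2.
Proof.
by have := qu xs v; rewrite gradient_argmin -(scale0r 0) dotZl mul0r addr0.
Qed.

(** Add the lower bound at [v] to the quadratic growth at [xs], apply Cauchy-Schwarz and cancel one
    factor |v - xs|. *)
Lemma argmin_dist v : sigma * enorm (v - xs) <= enorm (df v).
Proof.
have [->|vx] := eqVneq v xs; first by rewrite subrr enorm0 mulr0 enorm_ge0.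
have N0 : 0 < enorm (v - xs) by rewrite enorm_gt0 // subr_eq0.
rewrite -(ler_pM2r N0) -mulrA -expr2.
apply: le_trans (dot_le _ _).
have := gl (I : setT v) (I : setT xs); have := argmin_growth v.
by rewrite (enormB xs) -(opprB v xs) dotNr; lra.
Qed.

Lemma near_minP e v : near_min f e v <-> f v <= f xs + e.
Proof.
split=> [[m [[[u _ <-] ub]] h]|h].
  by apply: le_trans h _; rewrite lerD2r; apply: ub; exists xs.
by exists (f xs); split=> //; split; [exists xs|move=> _ [u _ <-]].
Qed.

Lemma near_min_dist e v : near_min f e v ->
  enorm (v - xs) <= Num.sqrt (2 * e / sigma).
Proof.
move=> /near_minP h; have := argmin_growth v => h1.
rewrite -[enorm _]ger0_norm ?enorm_ge0 // -sqrtr_sqr ler_wsqrtr //.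
by rewrite ler_pdivlMr //; lra.
Qed.

Let a : R := Num.sqrt sigma / Num.sqrt L.

Let rsL0 : 0 < Num.sqrt L. Proof. by rewrite sqrtr_gt0. Qed.
Let rss0 : 0 < Num.sqrt sigma. Proof. by rewrite sqrtr_gt0. Qed.
Let a0 : 0 < a. Proof. by rewrite divr_gt0. Qed.
Let a1 : a <= 1. Proof. by rewrite ler_pdivrMr // mul1r ler_wsqrtr. Qed.

(** Expresses the step size through the rate [a], which makes the potential estimate polynomial in a
    and a / sigma. *)
Let invLE : L^-1 = a * (a / sigma).
Proof.
rewrite /a; move: (sqr_sqrtr (ltW L0)) (sqr_sqrtr (ltW s0)) rsL0 rss0.
move: (Num.sqrt L) (Num.sqrt sigma) => b c <- <- b0 c0.
by field; rewrite !gt_eqF.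
Qed.

(* The second vector of the estimate sequence: the extrapolated point v is
   (x + a z) / (1 + a). *)
Definition agd_potential (s : 'rV[R]_n * 'rV[R]_n) : R :=
  f s.1 - f xs
  + sigma / 2 *
    enorm (s.2 + (Num.sqrt sigma / Num.sqrt L)^-1 *: (s.2 - s.1) - xs) ^+ 2.

(** The descent inequality for [x'] is combined with the strong convexity bounds at [v] towards [x],
    with weight 1 - a, and towards [xs], with weight a. The inner products with the gradient then
    cancel. *)
Lemma agd_potential_step x0 t :
  agd_potential (agd_state df L sigma x0 t.+1) <=
  (1 - a) * agd_potential (agd_state df L sigma x0 t).
Proof.
rewrite /agd_potential /= -/a; case: (agd_state _ _ _ _ t) => x v /=.
set z := v + a^-1 *: (v - x); set G := df v; set k := a / sigma.
set th := (_ - _) / (_ + _); set x' := v - _.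
have a'0 : a != 0 by rewrite gt_eqF.
have thE : th = (1 - a) / (1 + a).
  rewrite /th /a; field; rewrite gt_eqF //= -/a.
  by rewrite !gt_eqF ?addr_gt0.
(* The new [z] is a convex combination of the old [z] and [v], moved by -k times the gradient at
   [v]. *)
have -> : x' + th *: (x' - x) + a^-1 *: (x' + th *: (x' - x) - x') - xs =
   (1 - a) *: (z - xs) + a *: (v - xs) - k *: G.
  have a2 : a + 1 != 0 by rewrite gt_eqF // addr_gt0.
  apply/rowP => i; rewrite /x' /z invLE -/k thE !mxE; field.
  by rewrite a'0 addrC a2.
have sk : sigma * k = a by rewrite /k mulrCA divff ?mulr1 // gt_eqF.
have vx : x - v = - (a *: ((z - xs) - (v - xs))).
  by apply/rowP => i; rewrite /z !mxE; field.
have h1 : f x' <= f v - a * k / 2 * dot G G.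
  have := qu v x'; rewrite /x' -/G [v - _ - v]addrAC subrr add0r enormN enorm2.
  rewrite dotNr !dotE.
  have -> : L / 2 * (L^-1 * (L^-1 * dot G G)) = L^-1 / 2 * dot G G.
    by field; rewrite gt_eqF.
  by rewrite invLE -/k; lra.
have h2 := gl (I : setT v) (I : setT x).
have h3 := gl (I : setT v) (I : setT xs).
rewrite -/G vx enormN enorm2 in h2.
rewrite -/G -(opprB v xs) enormN enorm2 in h3.
rewrite !enorm2.
move: h1 h2 h3; move: (z - xs) (v - xs) => A B.
have h4 := dot_ge0 (A - B).
move: h4; rewrite !dotE (dotC B A) (dotC G A) (dotC G B).
have AA := dot_ge0 A; have BB := dot_ge0 B.
move: (dot A A) (dot A B) (dot B B) (dot A G) (dot B G) (dot G G) AA BB.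
move=> AA AB BB AG BG GG AA0 BB0 h4 h1 h2 h3.
have a10 : 0 <= 1 - a by rewrite subr_ge0.
(* The convexity defect of the squared norm between [A] and [B]; [h5] is the strong convexity term
   towards [x]. Both are discarded as nonnegative. *)
have h4' : 0 <= a * (1 - a) * (sigma / 2) * (AA - AB - (AB - BB)).
  by rewrite !mulr_ge0 // ?(ltW a0) ?(ltW s0) //; lra.
have h2' := ler_wpM2l a10 h2.
have h3' := ler_wpM2l (ltW a0) h3.
have h5 : 0 <= (1 - a) * (sigma / 2 * (a * (a * (AA - AB - (AB - BB))))).
  by rewrite !mulr_ge0 // ?(ltW a0) ?(ltW s0) //; lra.
(* [lra] treats products as atoms, so sigma k = a is supplied for each monomial where it is used. *)
have skX X : sigma * k * X = a * X by rewrite sk.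
move: (skX AG) (skX (a * AG)) (skX (a * BG)) (skX (k * GG)).
lra.
Qed.

Lemma agd_potential_pow x0 t :
  agd_potential (agd_state df L sigma x0 t) <=
  (1 - Num.sqrt sigma / Num.sqrt L) ^+ t * agd_potential (x0, x0).
Proof.
elim: t => [|t IH]; first by rewrite expr0 mul1r.
apply: le_trans (agd_potential_step _ _) _.
by rewrite exprS -mulrA ler_wpM2l // subr_ge0.
Qed.

(* Since 1 - a <= exp (- a), the geometric decay of the potential gives the
   iteration count ln (V / e) / a. *)
Lemma agd_reaches_after x0 e t (V : R) : 0 < e -> 0 < V ->
  agd_potential (x0, x0) <= V ->
  ln (V / e) <= Num.sqrt sigma / Num.sqrt L * t%:R ->
  agd_reaches f df L sigma x0 e t.
Proof.
move=> e0 V0 hV ht; apply/near_minP; rewrite -lerBlDl.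
apply: le_trans (_ : agd_potential (agd_state df L sigma x0 t) <= _).
  by rewrite lerDl mulr_ge0 ?sqr_ge0 // divr_ge0 ?(ltW s0).
apply: le_trans (agd_potential_pow _ _) _; rewrite -/a in ht *.
have a10 : 0 <= 1 - a by rewrite subr_ge0.
have h : (1 - a) ^+ t <= expR (- (a * t%:R)).
  rewrite -[X in expR X]mulNr expRM_natr lerXn2r ?nnegrE ?expR_ge0 //.
  exact: expR_ge1Dx.
apply: le_trans (ler_wpM2l (exprn_ge0 _ a10) hV) _.
apply: le_trans (ler_wpM2r (ltW V0) h) _.
rewrite -ler_pdivlMr // -[e / V]lnK ?posrE ?divr_gt0 // ler_expR.
by rewrite -(invf_div V e) lnV ?posrE ?divr_gt0 // lerN2.
Qed.

(** The bound uses the gradient at [x0] instead of the distance to [xs], because the former is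
    easily controlled uniformly over [Y]. *)
Lemma agd_potential0 x0 :
  agd_potential (x0, x0) <= L * (enorm (df x0) / sigma) ^+ 2.
Proof.
rewrite /agd_potential /= subrr scaler0 addr0.
have h1 := argmin_quad_upper x0.
have h2 : sigma * enorm (x0 - xs) ^+ 2 <= L * enorm (x0 - xs) ^+ 2.
  by rewrite ler_wpM2r ?sqr_ge0.
have h3 : L * enorm (x0 - xs) ^+ 2 <= L * (enorm (df x0) / sigma) ^+ 2.
  rewrite ler_pM2l // lerXn2r ?nnegrE ?divr_ge0 ?enorm_ge0 ?(ltW s0) //.
  by rewrite ler_pdivlMr // mulrC; exact: argmin_dist.
lra.
Qed.

(** If the first success came after more than B + 1 steps, the preceding step count would exceed B
    and already succeed. *)
Lemma agd_first_reaches_le x0 e t (V B : R) : 0 < e -> 0 < V -> 0 <= B ->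
  L * (enorm (df x0) / sigma) ^+ 2 <= V ->
  ln (V / e) <= Num.sqrt sigma / Num.sqrt L * B ->
  agd_first_reaches f df L sigma x0 e t -> t%:R <= B + 1.
Proof.
move=> e0 V0 B0 hV hB [_ ht]; case: t ht => [|t] ht; first by rewrite addr_ge0.
rewrite -natr1 lerD2r leNgt; apply/negP => Bt; apply: (ht t (ltnSn t)).
apply: (agd_reaches_after e0 V0 (le_trans (agd_potential0 x0) hV)).
by apply: le_trans hB _; rewrite ler_pM2l // ltW.
Qed.

Lemma agd_first_reaches_exists x0 e : 0 < e ->
  exists t, agd_first_reaches f df L sigma x0 e t.
Proof.
(* The added 1 keeps [V] positive when the gradient vanishes at [x0]. *)
move=> e0; pose V := L * (enorm (df x0) / sigma) ^+ 2 + 1.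
have V0 : 0 < V by rewrite ltr_wpDl // mulr_ge0 ?sqr_ge0 // ltW.
pose c := ln (V / e) / a.
have hr : exists t, `[< agd_reaches f df L sigma x0 e t >].
  exists (Num.trunc c).+1; apply/asboolP; apply: (agd_reaches_after e0 V0).
    by apply: le_trans (agd_potential0 x0) _; rewrite lerDl.
  by rewrite -/a [a * _]mulrC -ler_pdivrMr // ltW // truncnS_gt.
exists (ex_minn hr); case: ex_minnP => t /asboolP ht tmin; split=> // s st hs.
by move: (tmin s (asboolT hs)); rewrite leqNgt st.
Qed.

End Minimizer.
End SmoothStronglyConvex.

(** * Projections and sums *)

Section Projection.
Context {R : realType} {n : nat}.
Implicit Types (u v w y : 'rV[R]_n).

Lemma convex_set_segment (C : set 'rV[R]_n) : convex_set C -> segment_closed C.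
Proof.
move=> cC u v t Cu Cv /andP[t0 t1].
by have := cC u v (Itv01 t0 t1); rewrite !inE; apply.
Qed.

Lemma concave_on_sconvex (C : set 'rV[R]_n) (f : 'rV[R]_n -> R) :
  concave_on C f -> sconvex_on C 0 (fun v => - f v).
Proof.
move=> cf u v t Cu Cv /andP[t0 t1].
have := cf (Itv01 t0 t1) u v; rewrite !inE => /(_ Cu Cv).
by rewrite !mul0r subr0.
Qed.

Section Convex.
Context (Y : set 'rV[R]_n) (Yc : compact Y) (Y0 : Y !=set0) (Ys : segment_closed Y).

(** Compactness provides a nearest point, so [xget] never returns its default. *)
Lemma proj_spec v : Y (Defs.proj Y v) /\
  forall y, Y y -> enorm (v - Defs.proj Y v) <= enorm (v - y).
Proof.
pose P := [set u | Y u /\ forall y, Y y -> enorm (v - u) <= enorm (v - y)].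
suff : exists u, P u by exact: xgetPex.
have [|c Yc' cmin] := @compact_min _ _ Y (fun y => enorm (v - y)) Y0 Yc.
  move=> u Yu e e0; exists e => // w _; apply: le_lt_trans.
  rewrite ler_norml.
  have := enormBD u v w; have := enormBD w v u.
  by rewrite (enormB w u); lra.
by exists c.
Qed.

Lemma proj_in v : Y (Defs.proj Y v).
Proof. by case: (proj_spec v). Qed.

(** Moving a fraction [t] from the projection towards [y] cannot shorten the distance to [v]; the
    claim is the first-order part in [t]. *)
Lemma proj_variational v y : Y y -> dot (v - Defs.proj Y v) (y - Defs.proj Y v) <= 0.
Proof.
move=> Yy; have [Yu umin] := proj_spec v; set u := Defs.proj Y v in Yu umin *.
apply/ler_addgt0Pr => e e0; rewrite add0r.
pose c := enorm (y - u) ^+ 2; have c0 : 0 <= c := sqr_ge0 _.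
have c1 : 0 < c + 1 by rewrite ltr_wpDl.
pose t := Num.min (e / (c + 1)) 1.
have t0 : 0 < t by rewrite lt_min divr_gt0 //= ltr01.
have t1 : t <= 1 by rewrite ge_min lexx orbT.
have te : t * c <= e.
  apply: (@le_trans _ _ (t * (c + 1))); first by rewrite ler_pM2l // lerDl.
  by rewrite -ler_pdivlMr // ge_min lexx.
have := umin _ (Ys Yy Yu (_ : 0 <= t <= 1)); rewrite t1 (ltW t0) => /(_ isT).
have -> : v - (t *: y + (1 - t) *: u) = (v - u) - t *: (y - u).
  by apply/rowP => i; rewrite !mxE; ring.
rewrite -(ler_pXn2r (_ : 0 < 2)%N) ?nnegrE ?enorm_ge0 // !enorm2.
rewrite /c enorm2 in te *; move: te.
move: (v - u) (y - u) => a b; rewrite !dotE (dotC b a) => te h.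
have : t * (2 * dot a b) <= t * e.
  have := ler_wpM2l (ltW t0) te; lra.
by rewrite ler_pM2l //; lra.
Qed.

(** Add the variational inequalities of [v] and [w], each tested at the projection of the other. *)
Lemma proj_nonexpansive v w : enorm (Defs.proj Y v - Defs.proj Y w) <= enorm (v - w).
Proof.
have h1 := proj_variational v (proj_in w).
have h2 := proj_variational w (proj_in v).
have h3 := dot_le (v - w) (Defs.proj Y v - Defs.proj Y w).
set a := Defs.proj Y v in h1 h2 h3 *; set b := Defs.proj Y w in h1 h2 h3 *.
have h : enorm (a - b) ^+ 2 <= enorm (v - w) * enorm (a - b).
  by apply: le_trans h3; rewrite enorm2; move: h1 h2; rewrite !dotE; lra.
have [ab|ab] := eqVneq (enorm (a - b)) 0; first by rewrite ab enorm_ge0.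
by rewrite -(@ler_pM2r _ (enorm (a - b))) ?lt_neqAle ?enorm_ge0 1?eq_sym ?ab.
Qed.

(* The projection of w + s G maximizes s <G, y> - |y - w|^2 / 2 over Y, a
   1-strongly concave function of y. *)
Lemma proj_three_point w G (s : R) y : Y y ->
  s * dot G y - enorm (y - w) ^+ 2 / 2
    + enorm (y - Defs.proj Y (w + s *: G)) ^+ 2 / 2 <=
  s * dot G (Defs.proj Y (w + s *: G)) - enorm (Defs.proj Y (w + s *: G) - w) ^+ 2 / 2.
Proof.
move=> Yy; have := proj_variational (w + s *: G) Yy.
move: (Defs.proj _ _) => u; rewrite !enorm2 !dotE.
rewrite (dotC y u) (dotC w u) (dotC w y); lra.
Qed.

End Convex.
End Projection.

Lemma sum_nat1_recr (V : nmodType) (F : nat -> V) n :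
  \sum_(1 <= i < n.+2) F i = \sum_(1 <= i < n.+1) F i + F n.+1.
Proof. exact: big_nat_recr. Qed.

Lemma sumr_nat_id (R : realType) n :
  \sum_(1 <= i < n.+1) i%:R = n%:R * n.+1%:R / 2 :> R.
Proof.
elim: n => [|n IH]; first by rewrite big_geq // !mul0r.
by rewrite big_nat_recr //= IH -[n.+2%:R]natr1 -[n.+1%:R]natr1; field.
Qed.

(** For K >= 2 one has j^3 (j + 1) <= K^5, and |ln X| is absorbed because ln K >= ln 2. *)
Lemma ln_scaled_le (R : realType) (X : R) j K :
  0 < X -> (1 <= j <= K)%N -> (2 <= K)%N ->
  ln (X * (j ^ 3 * j.+1)%:R) <= (`|ln X| / ln 2 + 5) * ln K%:R.
Proof.
move=> X0 /andP[j0 jK] K2; have K0 : (0 < K)%N by exact: leq_trans K2.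
have l2 : 0 < ln (2 : R) by rewrite ln_gt0 // ltr1n.
have lK : ln (2 : R) <= ln K%:R by rewrite ler_ln ?posrE ?ltr0n // ler_nat.
have q0 : (0 < j ^ 3 * j.+1)%N by rewrite muln_gt0 expn_gt0 j0.
rewrite lnM ?posrE ?ltr0n // mulrDl; apply: lerD.
  apply: le_trans (ler_norm _) _; rewrite mulrAC ler_pdivlMr //.
  by rewrite ler_wpM2l.
have -> : 5 * ln (K%:R : R) = ln (K ^ 5)%:R.
  by rewrite natrX lnXn ?ltr0n // mulr_natl.
rewrite ler_ln ?posrE ?ltr0n ?expn_gt0 ?K0 // ler_nat.
rewrite (expnD K 3 2) leq_mul ?leq_exp2r // (leq_trans (_ : _ <= K.+1)%N) //.
by rewrite (leq_trans _ (leq_mul K2 (leqnn K))) // mul2n -addnn -add1n leq_add2r.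
Qed.

(** * The saddle-point problem *)

Section Saddle.
Context {R : realType} {p q : nat} (Y : set 'rV[R]_q)
  (g : 'rV[R]_p -> 'rV[R]_q -> R)
  (gx : 'rV[R]_p -> 'rV[R]_q -> 'rV[R]_p)
  (gy : 'rV[R]_p -> 'rV[R]_q -> 'rV[R]_q)
  (D L sigma : R) (x0 : 'rV[R]_p) (y0 : 'rV[R]_q).
Context (hsigma : 0 < sigma) (hsigmaL : sigma <= L)
  (Ys : segment_closed Y) (Yc : compact Y) (hy0 : Y y0)
  (hD : is_max [set enorm (y - y') | y in Y & y' in Y] D)
  (hsmooth : smooth_on Y L g gx gy)
  (hsc : forall y, Y y -> strongly_convex sigma (g^~ y))
  (hconcave : forall x, concave_on Y (g x)).

Let L0 : 0 < L := lt_le_trans hsigma hsigmaL.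
Let Y0 : Y !=set0 := ex_intro _ y0 hy0.

Lemma gradient_on_near x y (e : R) : Y y -> 0 < e ->
  exists2 d : R, 0 < d & forall x' y', Y y' ->
    enorm (x' - x) < d -> enorm (y' - y) < d ->
    `|g x' y' - g x y - dot (gx x y) (x' - x) - dot (gy x y) (y' - y)|
      <= e * (enorm (x' - x) + enorm (y' - y)).
Proof.
move=> Yy e0; have [hg _] := hsmooth; have := hg x y Yy e e0.
move=> [[A B] /= [/nbhs_enorm[a a0 aA] /nbhs_enorm[b b0 bB]] AB].
exists (Num.min a b); first by rewrite lt_min a0.
move=> x' y' Yy'; rewrite !lt_min => /andP[xa _] /andP[_ yb].
by apply: (AB (x', y')) => /=; split => //; [exact: aA|exact: bB].
Qed.

Lemma has_gradient_x y : Y y -> has_gradient_on setT (g^~ y) (gx^~ y).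
Proof.
move=> Yy x _ e e0; have [d d0 hd] := gradient_on_near x Yy e0.
exists d => // x' _ xd; have := hd x' y Yy xd.
rewrite subrr enorm0 => /(_ d0).
by rewrite -(scale0r 0) dotZr mul0r subr0 addr0.
Qed.

Lemma has_gradient_y x : has_gradient_on Y (g x) (gy x).
Proof.
move=> y Yy e e0; have [d d0 hd] := gradient_on_near x Yy e0.
exists d => // y' Yy' yd; have := hd x y' Yy'.
rewrite subrr enorm0 => /(_ d0 yd).
by rewrite -(scale0r 0) dotZr mul0r subr0 add0r.
Qed.

Lemma gx_lipschitz x x' y y' : Y y -> Y y' ->
  enorm (gx x y - gx x' y') <= L * (enorm (x - x') + enorm (y - y')).
Proof.
by move=> Yy Yy'; have := hsmooth.2 x y x' y' Yy Yy'; rewrite ge_max => /andP[].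
Qed.

Lemma gy_lipschitz x x' y y' : Y y -> Y y' ->
  enorm (gy x y - gy x' y') <= L * (enorm (x - x') + enorm (y - y')).
Proof.
by move=> Yy Yy'; have := hsmooth.2 x y x' y' Yy Yy'; rewrite ge_max => /andP[].
Qed.

Lemma g_grad_lower y : Y y -> grad_lower setT sigma (g^~ y) (gx^~ y).
Proof.
move=> Yy; apply: sconvex_grad_lower (has_gradient_x Yy) _; first exact: ltW.
  by [].
by move=> u v t _ _ /andP[t0 t1]; exact: hsc.
Qed.

Lemma g_quad_upper y : Y y -> quad_upper L (g^~ y) (gx^~ y).
Proof.
move=> Yy u v.
apply: (@gradient_step_bound _ _ setT (g^~ y) (gx^~ y) L (ltW L0) _ _ _ u v I I).
- by [].
- move=> {}u {}v _ _; have := g_grad_lower Yy (I : setT u) (I : setT v).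
  have : 0 <= sigma / 2 * enorm (v - u) ^+ 2.
    by rewrite mulr_ge0 ?sqr_ge0 // divr_ge0 // ltW.
  by lra.
- move=> {}u {}v _ _; have := gx_lipschitz u v Yy Yy.
  by rewrite subrr enorm0 addr0.
Qed.

(** Concavity enters as convexity of -g x on [Y], so that the first-order lemmas for convex
    functions apply. *)
Let neg_grad_lower x : grad_lower Y 0 (fun y => - g x y) (fun y => - gy x y).
Proof.
apply: sconvex_grad_lower => //; last exact: concave_on_sconvex.
move=> u Yu e e0; have [d d0 hd] := has_gradient_y x Yu e0.
exists d => // v Yv vd; have := hd v Yv vd.
by rewrite dotNl -normrN !opprB; congr (`|_| <= _); ring.
Qed.

Lemma g_concave_upper x u v : Y u -> Y v ->
  g x v <= g x u + dot (gy x u) (v - u).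
Proof.
by move=> Yu Yv; have := neg_grad_lower x Yu Yv; rewrite dotNl !mul0r; lra.
Qed.

Lemma g_concave_lower x u v : Y u -> Y v ->
  g x u + dot (gy x u) (v - u) - L / 2 * enorm (v - u) ^+ 2 <= g x v.
Proof.
move=> Yu Yv.
have := @gradient_step_bound _ _ Y _ _ L (ltW L0) Ys (neg_grad_lower x) _ u v Yu Yv.
rewrite dotNl; suff h : forall u v : 'rV[R]_q, Y u -> Y v ->
  enorm (- gy x u - - gy x v) <= L * enorm (u - v) by move=> /(_ h); lra.
move=> {Yu Yv}u {}v Yu Yv; have := gy_lipschitz x x Yu Yv.
by rewrite subrr enorm0 add0r -opprB opprK addrC enormN.
Qed.

(** * Dual implicit accelerated gradient *)

Definition argmin_x (y : 'rV[R]_q) : 'rV[R]_p :=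
  xget 0 [set x | forall v, g x y <= g v y].

Lemma argmin_xP y : Y y -> forall v, g (argmin_x y) y <= g v y.
Proof.
move=> Yy; pose P := [set x | forall v, g x y <= g v y].
suff : exists x, P x by exact: xgetPex.
exact: (sconvex_argmin hsigma (has_gradient_x Yy) (g_grad_lower Yy)).
Qed.

(** Since [gx] vanishes at (argmin_x y, y), its norm at (argmin_x y, y') is at most L |y - y'|;
    [argmin_dist] for [y'] then divides by sigma. *)
Lemma argmin_x_lipschitz y y' : Y y -> Y y' ->
  enorm (argmin_x y - argmin_x y') <= L / sigma * enorm (y - y').
Proof.
move=> Yy Yy'.
have h1 := argmin_dist hsigma hsigmaL (g_grad_lower Yy') (g_quad_upper Yy')
  (argmin_xP Yy') (argmin_x y).
have := gx_lipschitz (argmin_x y) (argmin_x y) Yy' Yy.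
rewrite (gradient_argmin hsigma hsigmaL (g_quad_upper Yy) (argmin_xP Yy)) subr0.
rewrite subrr enorm0 add0r.
move=> h2; rewrite mulrAC ler_pdivlMr // mulrC (enormB y).
exact: le_trans h1 h2.
Qed.

Lemma diam_ge y y' : Y y -> Y y' -> enorm (y - y') <= D.
Proof. by move=> Yy Yy'; apply: hD.2; exists y => //; exists y'. Qed.

Lemma diam_ge0 : 0 <= D.
Proof. by rewrite -(enorm0 : enorm (0 : 'rV[R]_q) = 0) -(subrr y0) diam_ge. Qed.

Let beta := diag_beta L sigma.

Let beta0 : 0 < beta.
Proof. by rewrite /beta /diag_beta divr_gt0 // mulr_gt0 // exprn_gt0. Qed.

(** In the outer step this lets the proximal term of [y1] absorb the curvature error of
    [g_concave_lower]. *)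
Lemma diag_beta_ge : L <= beta.
Proof.
rewrite /beta /diag_beta ler_pdivlMr // expr2.
have : L * sigma <= L * L by rewrite ler_pM2l.
have : 0 < L * L by rewrite mulr_gt0.
lra.
Qed.

Lemma eps_mp_gt0 e : 0 < e -> 0 < eps_mp L sigma e.
Proof.
move=> e0; rewrite /eps_mp mulr_gt0 ?divr_gt0 ?mulr_gt0 ?sqrtr_gt0 //.
by rewrite divr_gt0 ?mulr_gt0.
Qed.

Lemma eps_agd_gt0 e : 0 < e -> 0 < eps_agd L sigma beta e.
Proof.
move=> /eps_mp_gt0 m0; apply: divr_gt0; first apply: mulr_gt0.
- by rewrite mulr_gt0 // exprn_gt0.
- exact: exprn_gt0.
- by rewrite mulr_gt0 // exprn_gt0.
Qed.

Lemma imp_roundsP e : 0 < e ->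
  D / 2 ^+ imp_rounds D L sigma e <= eps_mp L sigma e / 2.
Proof.
move=> e0; have m0 := eps_mp_gt0 e0.
rewrite ler_pdivrMr ?exprn_gt0 // mulrAC ler_pdivlMr // mulrC [leRHS]mulrC.
(* For D = 0 the logarithm takes a default value, and the inequality holds because D / 2^N
   vanishes. *)
have [D0|D0] := leP D 0.
  apply: (@le_trans _ _ 0); first by lra.
  by rewrite mulr_ge0 ?exprn_ge0 // ltW.
have x0' : 0 < 2 * D / eps_mp L sigma e by rewrite divr_gt0 // mulr_gt0.
rewrite -ler_pdivrMr // -ler_ln ?posrE ?exprn_gt0 // lnXn // -[leRHS]mulr_natl.
have ln2 : 0 < ln (2 : R) by rewrite ln_gt0 // ltr1n.
rewrite -ler_pdivrMr // /imp_rounds; set c := ln _ / ln 2.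
apply: (le_trans (ceil_ge c)).
rewrite natr_absz ler_int; apply: le_trans (ler_norm _).
by rewrite le_max lexx orbT.
Qed.

(** * Convergence of the inner loop *)

Section ImpStepRun.
Context (w : 'rV[R]_q) (e : R) (T : nat -> nat) (hw : Y w) (e0 : 0 < e).
Let yy r := imp_y gx gy Y L sigma x0 w beta T r.
Let xx r := imp_x gx gy Y L sigma x0 w beta T r.
Let N := imp_rounds D L sigma e.
Let m := eps_mp L sigma e.
Context (hT : forall r, (r <= N)%N ->
  agd_reaches (g^~ (yy r)) (gx^~ (yy r)) L sigma x0 (eps_agd L sigma beta e) (T r)).

Lemma imp_y_in r : Y (yy r).
Proof. by case: r => //= r; exact: (proj_in Yc Y0). Qed.

(** [eps_agd] is chosen so that the distance sqrt (2 eps_agd / sigma) given by quadratic growth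
    equals this bound. *)
Lemma imp_x_dist r : (r <= N)%N ->
  enorm (xx r - argmin_x (yy r)) <= beta * m / (4 * L).
Proof.
move=> rN; have Yr := imp_y_in r.
have := near_min_dist hsigma hsigmaL (g_grad_lower Yr) (g_quad_upper Yr)
  (argmin_xP Yr) (hT rN).
move/le_trans; apply.
have -> : 2 * eps_agd L sigma beta e / sigma = (beta * m / (4 * L)) ^+ 2.
  rewrite /eps_agd -/m; field.
  by rewrite !gt_eqF.
have m0 : 0 < m by exact: eps_mp_gt0.
by rewrite sqrtr_sqr gtr0_norm // divr_gt0 // mulr_gt0.
Qed.

(** A round maps a bound d on the increment to d / 2 + m / 2, and [m] is the fixed point of this
    map; the part exceeding [m] is halved. *)
Lemma imp_y_dist r : (r <= N)%N -> enorm (yy r.+1 - yy r) <= D / 2 ^+ r + m.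
Proof.
have m0 : 0 < m by exact: eps_mp_gt0.
elim: r => [_|r IH rN].
  rewrite expr0 divr1; apply: le_trans (diam_ge (imp_y_in _) (imp_y_in _)) _.
  by rewrite lerDl ltW.
have h1 := IH (ltnW rN).
have h2 : enorm (xx r.+1 - xx r) <= L / sigma * enorm (yy r.+1 - yy r)
    + 2 * (beta * m / (4 * L)).
  have := imp_x_dist rN; have := imp_x_dist (ltnW rN).
  have := argmin_x_lipschitz (imp_y_in r.+1) (imp_y_in r).
  have := enormBD (argmin_x (yy r.+1)) (xx r.+1) (xx r).
  have := enormBD (argmin_x (yy r)) (argmin_x (yy r.+1)) (xx r).
  rewrite (enormB (argmin_x (yy r)) (xx r)).
  set A := enorm (xx r.+1 - xx r); lra.
apply: le_trans (proj_nonexpansive Yc Y0 Ys _ _) _.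
rewrite opprD addrACA subrr add0r -scalerBr enormZ gtr0_norm ?invr_gt0 //.
have h3 := gy_lipschitz (xx r.+1) (xx r) hw hw.
rewrite [w - w]subrr enorm0 addr0 in h3.
have h4 : enorm (gy (xx r.+1) w - gy (xx r) w) <=
   L * (L / sigma * (D / 2 ^+ r + m) + 2 * (beta * m / (4 * L))).
  apply: le_trans h3 _; rewrite ler_pM2l //; apply: le_trans h2 _.
  by rewrite lerD2r ler_wpM2l // divr_ge0 // ltW.
rewrite mulrC ler_pdivrMr //; apply: le_trans h4 _.
rewrite le_eqVlt; apply/orP; left; apply/eqP.
rewrite exprS /beta /diag_beta; field.
by rewrite !gt_eqF ?exprn_gt0.
Qed.

(** The point [xx N] is accurate for [yy N], whereas the claim concerns [yy N.+1]. Moving the argmin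
    costs (L / sigma) (3/2) m, and the error of AGD adds (L / sigma) m / 2. The constant 2/5 in
    [eps_mp] turns the resulting distance into a loss of 16/25 e. *)
Lemma imp_step_near :
  g (xx N) (yy N.+1) <= g (argmin_x (yy N.+1)) (yy N.+1) + e.
Proof.
have Y1 := imp_y_in N.+1; have m0 : 0 < m by exact: eps_mp_gt0.
apply: le_trans
  (argmin_quad_upper hsigma hsigmaL (g_quad_upper Y1) (argmin_xP Y1) _) _.
rewrite lerD2l.
have h1 : enorm (yy N.+1 - yy N) <= 3 / 2 * m.
  apply: le_trans (imp_y_dist (leqnn N)) _.
  by have : D / 2 ^+ N <= m / 2 := imp_roundsP e0; move: (D / _) => d; lra.
have h2 : enorm (xx N - argmin_x (yy N.+1)) <= 2 * (L / sigma) * m.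
  have := imp_x_dist (leqnn N).
  have -> : beta * m / (4 * L) = L / sigma * m / 2.
    by rewrite /beta /diag_beta; field; rewrite !gt_eqF.
  have := argmin_x_lipschitz (imp_y_in N) Y1; rewrite (enormB (yy N)).
  have := enormBD (argmin_x (yy N)) (xx N) (argmin_x (yy N.+1)).
  have Ls : 0 < L / sigma by rewrite divr_gt0.
  have := ler_wpM2l (ltW Ls) h1; lra.
have h3 : enorm (xx N - argmin_x (yy N.+1)) ^+ 2 <= (2 * (L / sigma) * m) ^+ 2.
  rewrite lerXn2r ?nnegrE ?enorm_ge0 //.
  by rewrite ltW // mulr_gt0 // mulr_gt0 // divr_gt0.
have : (2 * (L / sigma) * m) ^+ 2 = 32 / 25 * (e / L).
  rewrite /m /eps_mp !exprMn sqr_sqrtr; last by rewrite divr_ge0 ?mulr_ge0 // ltW.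
  by field; rewrite !gt_eqF.
move=> h4; rewrite h4 in h3.
have := ler_wpM2l (_ : 0 <= L / 2) h3; rewrite divr_ge0 ?(ltW L0) // => /(_ isT).
have -> : L / 2 * (32 / 25 * (e / L)) = 16 / 25 * e by field; rewrite gt_eqF.
by move/le_trans; apply; rewrite ger_pMl //; lra.
Qed.
End ImpStepRun.

(** * One step of accelerated ascent on the dual function *)

Let val_min y := g (argmin_x y) y.

(** The three-point inequality is used for [y1] against the mixture of [y] and [z1], and for [z1]
    against [yt]. The term in |z1 - z|^2 lost in the first is paid for by the second. *)
Lemma outer_step k x w y z y1 z1 e yt :
  Y y -> Y z -> Y yt -> w = (1 - diag_tau k) *: y + diag_tau k *: z ->
  y1 = Defs.proj Y (w + beta^-1 *: gy x w) ->
  z1 = Defs.proj Y (z + diag_eta L sigma k *: gy x w) ->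
  g x y1 <= val_min y1 + e ->
  k%:R * k.+1%:R * val_min y + 2 * k.+1%:R * g x yt
    - 2 * beta * (enorm (yt - z) ^+ 2 - enorm (yt - z1) ^+ 2)
  <= k.+1%:R * k.+2%:R * (val_min y1 + e).
Proof.
move=> Yy Yz Yyt wE y1E z1E hy1.
have Yy1 : Y y1 by rewrite y1E; exact: (proj_in Yc Y0).
have Yz1 : Y z1 by rewrite z1E; exact: (proj_in Yc Y0).
set t : R := diag_tau k in wE *.
have n0 : 0 < k.+1%:R :> R by rewrite ltr0n.
have n20 : 0 < k.+2%:R :> R by rewrite ltr0n.
have t0 : 0 <= t by rewrite divr_ge0.
have tn : t * k.+2%:R = 2 by rewrite /t /diag_tau mulfVK // gt_eqF.
have tI : 0 <= 1 - t <= 1.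
  rewrite subr_ge0 gerBl t0 andbT ler_pdivrMr // mul1r ler_nat.
  by rewrite ltnS.
have tE : t = 1 - (1 - t) by rewrite subKr.
have Yw : Y w by rewrite wE {2}tE; exact: Ys.
(* This test point mixes [y] and [z1] with the weights of [w], so its difference from [w] is t (z1 -
   z). *)
have Yv : Y ((1 - t) *: y + t *: z1) by rewrite {2}tE; exact: Ys.
have f1 := proj_three_point Yc Y0 Ys w (gy x w) beta^-1 Yv.
have f3 := proj_three_point Yc Y0 Ys z (gy x w) (diag_eta L sigma k) Yyt.
rewrite -y1E in f1; rewrite -z1E in f3.
have f2 := g_concave_lower x Yw Yy1.
have f4 := g_concave_upper x Yw Yy.
have f5 := g_concave_upper x Yw Yyt.
have f6 : val_min y <= g x y := argmin_xP Yy x.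
have vw : (1 - t) *: y + t *: z1 - w = t *: (z1 - z).
  by rewrite wE; apply/rowP => i; rewrite !mxE; ring.
rewrite vw enormZ (ger0_norm t0) in f1.
have N0 : 0 <= enorm ((1 - t) *: y + t *: z1 - y1) ^+ 2 by rewrite sqr_ge0.
have f1' : dot (gy x w) ((1 - t) *: y + t *: z1)
    - beta * (t * enorm (z1 - z)) ^+ 2 / 2
  <= dot (gy x w) y1 - beta * enorm (y1 - w) ^+ 2 / 2.
  have E X : beta * (beta^-1 * X) = X by rewrite mulrA divff ?mul1r // gt_eqF.
  have := ler_wpM2l (ltW beta0) f1; rewrite mulrDr !mulrBr !E.
  have := mulr_ge0 (ltW beta0) N0; lra.
have f3' : k.+1%:R * dot (gy x w) yt - beta * enorm (yt - z) ^+ 2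
    + beta * enorm (yt - z1) ^+ 2
  <= k.+1%:R * dot (gy x w) z1 - beta * enorm (z1 - z) ^+ 2.
  have b2 : 0 < 2 * beta by rewrite mulr_gt0.
  have := ler_wpM2l (ltW b2) f3.
  rewrite /diag_eta -/beta.
  have E X : 2 * beta * (k.+1%:R / (2 * beta) * X) = k.+1%:R * X.
    by field; rewrite gt_eqF.
  by rewrite mulrDr !mulrBr !E; lra.
have f2' : beta / 2 * enorm (y1 - w) ^+ 2 >= L / 2 * enorm (y1 - w) ^+ 2.
  by rewrite ler_wpM2r ?sqr_ge0 // ler_pM2r // diag_beta_ge.
rewrite !dotE in f1' f2 f4 f5; clear f1 f3.
move: f1' f2 f3' f4 f5 f6 f2' hy1.
have Z0 : 0 <= beta * enorm (z1 - z) ^+ 2 by rewrite mulr_ge0 ?sqr_ge0 // ltW.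
rewrite exprMn; move: (enorm (z1 - z) ^+ 2) Z0.
move: (enorm (y1 - w) ^+ 2) (enorm (yt - z) ^+ 2) (enorm (yt - z1) ^+ 2).
move: (dot (gy x w) y) (dot (gy x w) z1) (dot (gy x w) y1) (dot _ w) (dot _ yt).
move: (g x w) (g x y) (g x y1) (g x yt) (val_min y) (val_min y1).
move=> gw gyy gy1 gt hy hy1 Gy Gz1 Gy1 Gw Gt Y1 A B Z Z0 f1 f2 f3 f4 f5 f6 f2' f7.
have kE : k%:R = k.+1%:R - 1 :> R by rewrite -natr1 addrK.
have k2E : k.+2%:R = k.+1%:R + 1 :> R by rewrite -natr1.
have k0 : 0 <= k%:R :> R by rewrite ler0n.
rewrite kE k2E in k0 tn n20 *.
move: (k.+1%:R) n0 n20 tn kE k2E k0 f3 => n n0 n20 tn _ _ n1 f3.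
clear - n0 n20 tn n1 f1 f2 f3 f4 f5 f6 f2' f7 Z0 t0.
clearbody t beta.
have a1 : gw - Gw + (1 - t) * Gy + t * Gz1 - beta * (t ^+ 2 * Z) / 2 <= hy1 + e.
  lra.
have nn : 0 <= n * (n + 1) by rewrite mulr_ge0 // ltW.
have a2 := ler_wpM2l nn a1.
have nn1 : 0 <= n * (n - 1) by rewrite mulr_ge0 // ltW.
have a3 : n * (n - 1) * hy <= n * (n - 1) * (gw + (Gy - Gw)).
  by rewrite ler_wpM2l //; lra.
have a4 : 2 * n * gt <= 2 * n * (gw + (Gt - Gw)).
  by rewrite ler_wpM2l ?mulr_ge0 ?(ltW n0).
(* Here n = k + 1 and t (n + 1) = 2, so scaling [a1] by n (n + 1) leaves n t beta Z, while twice
   [f3] supplies 2 beta Z. *)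
have a5 : n * t <= 2 by rewrite -tn mulrC ler_wpM2l //; lra.
have a6 : n * t * (beta * Z) <= 2 * (beta * Z) by rewrite ler_wpM2r.
have tnX X : t * (n + 1) * X = 2 * X by rewrite tn.
have := tnX (n * Gy); have := tnX (n * Gz1); have := tnX (n * t * (beta * Z)).
lra.
Qed.

(** * Telescoping, averaging and the duality gap *)

Section Run.
Context (eps : nat -> R) (T : nat -> nat -> nat).
Let st k := diag_state gx gy Y D L sigma x0 y0 eps T k.
Let ww k := diag_w gx gy Y D L sigma x0 y0 eps T k.

Lemma diag_stateS k : st k.+1 =
  let w := ww k in
  let N := imp_rounds D L sigma (eps k.+1) in
  DiagPoint (imp_x gx gy Y L sigma x0 w beta (T k) N)
    (imp_y gx gy Y L sigma x0 w beta (T k) N.+1)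
    (Defs.proj Y (pt_z (st k) + diag_eta L sigma k *:
       gy (imp_x gx gy Y L sigma x0 w beta (T k) N) w)).
Proof. by []. Qed.

Lemma diag_state_in k : [/\ Y (pt_y (st k)), Y (pt_z (st k)) & Y (ww k)].
Proof.
suff [Yy Yz] : Y (pt_y (st k)) /\ Y (pt_z (st k)).
  split=> //; rewrite /ww /diag_w /mix.
  have {2}-> : diag_tau k = 1 - (1 - diag_tau k) :> R by rewrite subKr.
  apply: Ys => //; rewrite subr_ge0 gerBl divr_ge0 // andbT.
  by rewrite ler_pdivrMr ?ltr0n // mul1r ler_nat ltnS.
by case: k => [//|k]; rewrite diag_stateS; split; exact: (proj_in Yc Y0).
Qed.

Context (K : nat) (heps : forall k, (1 <= k <= K)%N -> 0 < eps k)
  (hrun : diag_run g gx gy Y D L sigma x0 y0 eps T K).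

Lemma diag_step yt k : Y yt -> (k < K)%N ->
  k%:R * k.+1%:R * val_min (pt_y (st k)) + 2 * k.+1%:R * g (pt_x (st k.+1)) yt
    - 2 * beta * (enorm (yt - pt_z (st k)) ^+ 2 - enorm (yt - pt_z (st k.+1)) ^+ 2)
  <= k.+1%:R * k.+2%:R * (val_min (pt_y (st k.+1)) + eps k.+1).
Proof.
move=> Yt kK; have [Yy Yz Yw] := diag_state_in k.
have near := imp_step_near Yw (heps (kK : 1 <= k.+1 <= K)%N)
  (fun r => hrun kK (r := r)).
exact: (outer_step Yy Yz Yt erefl erefl erefl near).
Qed.

Lemma diag_telescope yt k : Y yt -> (k <= K)%N ->
  2 * (\sum_(1 <= i < k.+1) i%:R * g (pt_x (st i)) yt)
    - 2 * beta * (enorm (yt - y0) ^+ 2 - enorm (yt - pt_z (st k)) ^+ 2)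
  <= (k * k.+1)%:R * val_min (pt_y (st k))
    + \sum_(1 <= i < k.+1) (i * i.+1)%:R * eps i.
Proof.
move=> Yt; elim: k => [|k IH] kK.
  by rewrite !big_geq // mul0n mul0r subrr !mulr0 subr0 addr0.
have := IH (ltnW kK); have := diag_step Yt kK.
rewrite !sum_nat1_recr; move: (st k.+1) (st k) => s s'; rewrite !natrM.
move: (\sum_(1 <= i < k.+1) _) (\sum_(1 <= i < k.+1) _) => S1 S2; lra.
Qed.

Let xbar := diag_xbar gx gy Y D L sigma x0 y0 eps T K.

(** Jensen through the tangent at [xbar]: summing the affine minorant of [g^~ yt] with weights i
    makes the linear part cancel, as [xbar] is the weighted mean. *)
Lemma diag_jensen yt : Y yt -> (0 < K)%N ->
  K%:R * K.+1%:R / 2 * g xbar yt <=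
  \sum_(1 <= i < K.+1) i%:R * g (pt_x (st i)) yt.
Proof.
move=> Yt K0; pose G := gx xbar yt.
have H n : (\sum_(1 <= i < n.+1) i%:R) * (g xbar yt - dot G xbar)
    + dot G (\sum_(1 <= i < n.+1) i%:R *: pt_x (st i))
    <= \sum_(1 <= i < n.+1) i%:R * g (pt_x (st i)) yt.
  elim: n => [|n IH].
    by rewrite !big_geq // mul0r add0r -(scale0r 0) dotZr mul0r.
  rewrite !sum_nat1_recr dotDr dotZr.
  have := g_grad_lower Yt (I : setT xbar) (I : setT (pt_x (st n.+1))).
  rewrite -/G dotDr dotNr; set z := pt_x _; move: z => z h1.
  have h2 : g xbar yt + (dot G z - dot G xbar) <= g z yt.
    apply: le_trans h1; rewrite lerDl.
    by rewrite mulr_ge0 ?sqr_ge0 // divr_ge0 // ltW.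
  have := ler_wpM2l (ler0n R n.+1) h2; lra.
have KK : 0 < K%:R * K.+1%:R :> R by rewrite mulr_gt0 ?ltr0n.
have := H K; rewrite sumr_nat_id.
have -> : \sum_(1 <= i < K.+1) i%:R *: pt_x (st i)
    = (K%:R * K.+1%:R / 2) *: xbar.
  rewrite /xbar /diag_xbar scalerA mulrA divfK // divff ?scale1r //.
  by rewrite gt_eqF.
by rewrite [dot G (_ *: xbar)]dotZr -mulrDr subrK.
Qed.

Lemma diag_gap : (0 < K)%N ->
  gap_le Y g xbar (diag_y gx gy Y D L sigma x0 y0 eps T K)
    ((4 * (L ^+ 2 / sigma) * D ^+ 2
      + \sum_(1 <= k < K.+1) (k * k.+1)%:R * eps k) / (K * K.+1)%:R).
Proof.
move=> K0; have [Yy _ _] := diag_state_in K.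
(* The competitor is a maximizer for [xbar]; it may depend on the whole run because the telescoped
   bound holds for every point of [Y]. *)
have [|yt Yt ytmax] := @compact_min _ _ Y (fun y => - g xbar y) Y0 Yc.
  move=> y Yyy e e0.
  have [d d0 hd] := has_gradient_continuous (has_gradient_y xbar) Yyy e0.
  by exists d => // v Yv vd; rewrite -normrN opprB opprK addrC hd.
exists (g xbar yt), (val_min (pt_y (st K))); split.
- split; first by exists yt.
  by move=> _ [y Yyy <-]; have := ytmax y Yyy; rewrite lerN2.
- split; first by exists (argmin_x (pt_y (st K))).
  by move=> _ [v _ <-]; exact: argmin_xP.
have KK : 0 < (K * K.+1)%:R :> R by rewrite ltr0n muln_gt0 K0.
rewrite ler_pdivlMr //.
have h1 := diag_telescope Yt (leqnn K).
have := diag_jensen Yt K0; rewrite -natrM => h2.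
have h3 : 2 * beta * (enorm (yt - y0) ^+ 2 - enorm (yt - pt_z (st K)) ^+ 2)
    <= 4 * (L ^+ 2 / sigma) * D ^+ 2.
  have -> : 4 * (L ^+ 2 / sigma) = 2 * beta.
    by rewrite /beta /diag_beta; field; rewrite gt_eqF.
  rewrite ler_pM2l; last by rewrite mulr_gt0.
  have : enorm (yt - y0) ^+ 2 <= D ^+ 2.
    by rewrite lerXn2r ?nnegrE ?enorm_ge0 ?diam_ge0 // diam_ge.
  have := sqr_ge0 (enorm (yt - pt_z (st K))); lra.
move: h1 h2 h3; move: (2 * beta * _) (4 * _ * _) ((K * K.+1)%:R) => c d n.
move: (\sum_(1 <= i < _) _) (\sum_(1 <= i < _) _) => S1 S2.
move: (g xbar yt) (val_min (pt_y (st K))) => a b.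
lra.
Qed.
End Run.

(** * Existence of runs *)

Let reached e (y : 'rV[R]_q) t :=
  agd_first_reaches (g^~ y) (gx^~ y) L sigma x0 e t.

Let stop_time e y : nat := xget 0%N [set t | reached e y t].

Let stop_timeP e y : 0 < e -> Y y -> reached e y (stop_time e y).
Proof.
move=> e0 Yy; pose P := [set t | reached e y t].
suff : exists t, P t by exact: xgetPex.
exact: (agd_first_reaches_exists hsigma hsigmaL (g_grad_lower Yy) (g_quad_upper Yy)
  (argmin_xP Yy)).
Qed.

(* A run length may be prescribed as a function of the current iterate; reading
   the lengths off along the iterates breaks the mutual dependency between
   imp_y and T. *)
Fixpoint stopped_y (S : 'rV[R]_q -> nat) w r : 'rV[R]_q :=
  if r is r'.+1 then
    let y := stopped_y S w r' in
    Defs.proj Y (w + beta^-1 *: gy (agd (gx^~ y) L sigma x0 (S y)) w)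
  else w.

Lemma stopped_yE S w r :
  imp_y gx gy Y L sigma x0 w beta (S \o stopped_y S w) r = stopped_y S w r.
Proof. by elim: r => [|r IH]; [|rewrite /= IH]. Qed.

(** The device of [stopped_y] one level up: the lengths in iteration k depend on [w], which depends
    on all earlier lengths. *)
Fixpoint stopped_state (S : nat -> 'rV[R]_q -> nat) (eps : nat -> R) k :
    diag_point :=
  if k is k'.+1 then
    let s := stopped_state S eps k' in
    let w := mix k' s in
    let: (x, y) := imp_step gx gy Y D L sigma x0 w beta
                     (S k' \o stopped_y (S k') w) (eps k'.+1) in
    DiagPoint x y (Defs.proj Y (pt_z s + diag_eta L sigma k' *: gy x w))
  else DiagPoint x0 y0 y0.

Lemma stopped_stateE S eps k :
  diag_state gx gy Y D L sigma x0 y0 eps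
    (fun k => S k \o stopped_y (S k) (mix k (stopped_state S eps k))) k
  = stopped_state S eps k.
Proof. by elim: k => [|k IH]; [|rewrite /= IH]. Qed.

Lemma diag_first_run_exists eps K :
  (forall k, (1 <= k <= K)%N -> 0 < eps k) ->
  exists T, diag_first_run g gx gy Y D L sigma x0 y0 eps T K.
Proof.
move=> heps.
pose S k := stop_time (eps_agd L sigma beta (eps k.+1)).
pose T k := S k \o stopped_y (S k) (mix k (stopped_state S eps k)).
(* Iterates stay in [Y] whatever the lengths are, so this is available before [T] is known to
   describe a run. *)
have Yw k : Y (mix k (stopped_state S eps k)).
  have [_ _] := diag_state_in eps T k.
  by rewrite /diag_w stopped_stateE.
exists T => k r kK _ /=; rewrite /diag_w stopped_stateE stopped_yE.
apply: stop_timeP; first by apply: eps_agd_gt0; exact: heps.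
by rewrite -stopped_yE; exact: (imp_y_in _ (Yw k)).
Qed.

(** * Oracle complexity for the prescribed tolerances *)

Section Complexity.
Context (D0 : 0 < D).
Let eps (k : nat) : R := L ^+ 2 * D ^+ 2 / (sigma * (k ^ 3 * k.+1)%:R).

Let eps_gt0 k : (1 <= k)%N -> 0 < eps k.
Proof.
move=> k0; rewrite /eps divr_gt0 // mulr_gt0 ?exprn_gt0 //.
by rewrite ltr0n muln_gt0 expn_gt0 k0.
Qed.

Let eps_mp2 k : (1 <= k)%N ->
  eps_mp L sigma (eps k) ^+ 2 = 8 * sigma * D ^+ 2 / (25 * L * (k ^ 3 * k.+1)%:R).
Proof.
move=> k0; have q0 : 0 < (k ^ 3 * k.+1)%:R :> R.
  by rewrite ltr0n muln_gt0 expn_gt0 k0.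
rewrite /eps_mp exprMn sqr_sqrtr; last first.
  by rewrite ltW // divr_gt0 // mulr_gt0 // eps_gt0.
rewrite /eps; move: ((k ^ 3 * k.+1)%:R) q0 => q' q0; field.
by rewrite !gt_eqF.
Qed.

Let eps_agdE k : (1 <= k)%N ->
  eps_agd L sigma beta (eps k) = L * D ^+ 2 / (25 * (k ^ 3 * k.+1)%:R).
Proof.
move=> k0; have q0 : 0 < (k ^ 3 * k.+1)%:R :> R.
  by rewrite ltr0n muln_gt0 expn_gt0 k0.
rewrite /eps_agd eps_mp2 // /beta /diag_beta.
move: ((k ^ 3 * k.+1)%:R) q0 => q' q0; field.
by rewrite !gt_eqF.
Qed.

(** Squaring 2 D / eps_mp removes the root and leaves a constant times j^3 (j + 1). The two units
    from the ceiling and the extra round are absorbed by 2 / ln 2. *)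
Lemma imp_rounds_le j K : (1 <= j <= K)%N -> (2 <= K)%N ->
  (imp_rounds D L sigma (eps j)).+1%:R <=
  ((`|ln (25 * L / (2 * sigma))| / ln 2 + 5) / (2 * ln 2) + 2 / ln 2) * ln (K%:R : R).
Proof.
move=> jK K2; have /andP[j0 _] := jK.
have l2 : 0 < ln (2 : R) by rewrite ln_gt0 // ltr1n.
have K0 : (0 < K)%N by exact: leq_trans K2.
have lK : ln (2 : R) <= ln K%:R by rewrite ler_ln ?posrE ?ltr0n // ler_nat.
have q0 : 0 < (j ^ 3 * j.+1)%:R :> R.
  by rewrite ltr0n muln_gt0 expn_gt0 j0.
have m0 := eps_mp_gt0 (eps_gt0 j0).
have X0 : 0 < 25 * L / (2 * sigma) by rewrite divr_gt0 ?mulr_gt0.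
have h := ln_scaled_le X0 jK K2.
have E : 2 * ln (2 * D / eps_mp L sigma (eps j))
   = ln (25 * L / (2 * sigma) * (j ^ 3 * j.+1)%:R).
  have a0 : 0 < 2 * D / eps_mp L sigma (eps j) by rewrite divr_gt0 // mulr_gt0.
  rewrite mulr_natl -(lnXn 2 a0) expr_div_n eps_mp2 //.
  congr ln; move: ((j ^ 3 * j.+1)%:R) q0 => q' q0'; field.
  by rewrite !gt_eqF.
rewrite -{}E in h.
set M := `|_| / _ + 5 in h *.
have M0 : 0 <= M by rewrite addr_ge0 // divr_ge0 ?(ltW l2).
have lK0 : 0 < ln (K%:R : R) by exact: lt_le_trans lK.
have h1 : 1 <= ln K%:R / ln (2 : R) by rewrite ler_pdivlMr // mul1r.
rewrite -natr1 /imp_rounds; set c := ln (_ / _) / ln 2.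
have h2 : c <= M / (2 * ln 2) * ln K%:R.
  have -> : M / (2 * ln 2) * ln K%:R = M * ln K%:R / 2 / ln (2 : R).
    by field; rewrite gt_eqF.
  by rewrite /c ler_pM2r ?invr_gt0 //; lra.
have h3 : 0 <= M / (2 * ln 2) * ln K%:R.
  by rewrite mulr_ge0 ?(ltW lK0) // divr_ge0 // mulr_ge0 ?(ltW l2).
rewrite natr_absz ger0_norm ?le_max ?lexx //.
have h4 : (Num.max (0 : int) (Num.ceil c))%:~R <= M / (2 * ln 2) * ln K%:R + 1.
  rewrite /Num.max; case: ifP => _; last by rewrite addr_ge0.
  have := ceilB1_lt c; rewrite intrB => /ltW; rewrite lerBlDr => /le_trans; apply.
  by rewrite lerD2r.
rewrite mulrDl; lra.
Qed.

(** The constant must precede the run: it depends only on the data, and its term M1 / a contains the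
    factor sqrt (L / sigma). *)
Lemma agd_length_le : exists2 M : R, 0 <= M & forall T k r K,
  diag_first_run g gx gy Y D L sigma x0 y0 eps T K -> (2 <= K)%N ->
  (k < K)%N -> (r <= imp_rounds D L sigma (eps k.+1))%N ->
  (T k r + 1)%:R <= M * ln (K%:R : R).
Proof.
have l2 : 0 < ln (2 : R) by rewrite ln_gt0 // ltr1n.
pose a := Num.sqrt sigma / Num.sqrt L.
have a0 : 0 < a by rewrite divr_gt0 ?sqrtr_gt0.
(* Bounds the starting potential for every y in [Y], since |gx x0 y| <= |gx x0 y0| + L D. Below, [X]
   is V / eps_agd without the factor j^3 (j + 1). *)
pose V := L * ((enorm (gx x0 y0) + L * D) / sigma) ^+ 2 + 1.
have V0 : 0 < V by rewrite ltr_wpDl // mulr_ge0 ?sqr_ge0 // ltW.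
pose X := 25 * V / (L * D ^+ 2).
have X0 : 0 < X by rewrite divr_gt0 ?mulr_gt0 ?exprn_gt0.
pose M1 := `|ln X| / ln 2 + 5.
have M10 : 0 <= M1 by rewrite addr_ge0 // divr_ge0 // ltW.
exists (M1 / a + 2 / ln 2).
  by rewrite addr_ge0 // divr_ge0 // ltW.
move=> T k r K hrun K2 kK rk.
have lK : ln (2 : R) <= ln K%:R.
  by rewrite ler_ln ?posrE ?ltr0n ?(leq_trans _ K2) // ler_nat.
have lK0 : 0 < ln (K%:R : R) by exact: lt_le_trans lK.
have h1 : 1 <= ln K%:R / ln (2 : R) by rewrite ler_pdivlMr // mul1r.
have [_ _ Yw] := diag_state_in eps T k.
have := hrun k r kK rk.
have := imp_y_in (T k) Yw r => /=.
move: (imp_y _ _ _ _ _ _ _ _ _ _) => y Yy hfirst.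
have e0 := eps_agd_gt0 (eps_gt0 (ltn0Sn k)).
have hV : L * (enorm (gx x0 y) / sigma) ^+ 2 <= V.
  rewrite (@le_trans _ _ (L * ((enorm (gx x0 y0) + L * D) / sigma) ^+ 2)) //; last by rewrite lerDl.
  rewrite ler_pM2l // lerXn2r ?nnegrE ?divr_ge0 ?addr_ge0 ?enorm_ge0 ?(ltW hsigma) //.
    by rewrite mulr_ge0 // ltW.
  rewrite ler_pM2r ?invr_gt0 //.
  have := enormD (gx x0 y0) (gx x0 y - gx x0 y0); rewrite addrC subrK.
  move/le_trans; apply; rewrite lerD2l.
  apply: le_trans (gx_lipschitz x0 x0 Yy hy0) _.
  by rewrite subrr enorm0 add0r ler_pM2l // (diam_ge).
have hB : ln (V / eps_agd L sigma beta (eps k.+1)) <= a * (M1 * ln K%:R / a).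
  rewrite [leRHS]mulrC divfK ?gt_eqF //.
  have -> : V / eps_agd L sigma beta (eps k.+1) = X * (k.+1 ^ 3 * k.+2)%:R.
    have q0 : 0 < (k.+1 ^ 3 * k.+2)%:R :> R by rewrite ltr0n.
    rewrite eps_agdE // /X; move: (V) ((k.+1 ^ 3 * k.+2)%:R) q0 => v q' q0.
    by field; rewrite !gt_eqF.
  exact: ln_scaled_le.
have B0 : 0 <= M1 * ln K%:R / a.
  by rewrite divr_ge0 ?(ltW a0) // mulr_ge0 // ltW.
have := agd_first_reaches_le hsigma hsigmaL (g_grad_lower Yy) (g_quad_upper Yy)
  (argmin_xP Yy) e0 V0 B0 hV hB hfirst.
rewrite natrD [M1 * _ / a]mulrAC => h2; rewrite mulrDl.
have -> : 2 / ln 2 * ln K%:R = 2 * (ln K%:R / ln (2 : R)) by rewrite mulrAC mulrA.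
lra.
Qed.

(** Each iteration costs rounds times call length, a product of two logarithmic bounds, plus one
    evaluation, which is at most (ln K / ln 2)^2. *)
Lemma diag_oracle_calls_le : exists2 M : R, 0 <= M & forall T K,
  diag_first_run g gx gy Y D L sigma x0 y0 eps T K -> (2 <= K)%N ->
  (diag_oracle_calls D L sigma eps T K)%:R <= M * (K%:R * ln (K%:R : R) ^+ 2).
Proof.
have l2 : 0 < ln (2 : R) by rewrite ln_gt0 // ltr1n.
have [M1 M10 hM1] := agd_length_le.
pose M2 := ((`|ln (25 * L / (2 * sigma))| / ln 2 + 5) / (2 * ln 2) + 2 / ln 2).
have M20 : 0 <= M2.
  by rewrite addr_ge0 // divr_ge0 ?addr_ge0 // ?divr_ge0 ?mulr_ge0 // ltW.
exists (M2 * M1 + (ln 2)^-1 ^+ 2).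
  by rewrite addr_ge0 ?sqr_ge0 // mulr_ge0.
move=> T K hrun K2.
have lK : ln (2 : R) <= ln K%:R.
  by rewrite ler_ln ?posrE ?ltr0n ?(leq_trans _ K2) // ler_nat.
have lK0 : 0 < ln (K%:R : R) by exact: lt_le_trans lK.
rewrite /diag_oracle_calls natr_sum.
have -> : (M2 * M1 + (ln 2)^-1 ^+ 2) * (K%:R * ln (K%:R : R) ^+ 2) =
   \sum_(k < K) (M2 * ln K%:R * (M1 * ln K%:R) + (ln K%:R / ln 2) ^+ 2).
  by rewrite sumr_const card_ord -mulr_natr; ring.
apply: ler_sum => k _; rewrite natrD natr_sum; apply: lerD.
  have h1 : (imp_rounds D L sigma (eps k.+1)).+1%:R <= M2 * ln (K%:R : R).
    by apply: imp_rounds_le => //=; exact: ltn_ord.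
  apply: le_trans (ler_wpM2r _ h1); last by rewrite mulr_ge0 // ltW.
  rewrite mulr_natl -[X in _ *+ X]card_ord -sumr_const.
  apply: ler_sum => r _; apply: hM1 hrun K2 _ _; first exact: ltn_ord.
  by rewrite -ltnS ltn_ord.
rewrite -[leLHS](expr1n _ 2) lerXn2r ?nnegrE ?divr_ge0 ?(ltW lK0) ?(ltW l2) //.
by rewrite ler_pdivlMr // mul1r.
Qed.

(** The terms are a constant over k^2, and 1 / (n + 2)^2 <= 1 / (n + 1) - 1 / (n + 2) telescopes.
    The resulting 2 turns the constant 4 of the gap into 6. *)
Lemma tolerance_sum_le K : (1 <= K)%N ->
  \sum_(1 <= k < K.+1) (k * k.+1)%:R * eps k <= 2 * (L ^+ 2 / sigma) * D ^+ 2.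
Proof.
move=> K0.
suff H n : \sum_(1 <= k < n.+2) (k * k.+1)%:R * eps k
    <= L ^+ 2 / sigma * D ^+ 2 * (2 - n.+1%:R^-1).
  case: K K0 => // K _; apply: le_trans (H K) _.
  rewrite -[leRHS]mulrA [leRHS]mulrC ler_wpM2l //.
    by rewrite mulr_ge0 ?sqr_ge0 // divr_ge0 ?sqr_ge0 // ltW.
  by rewrite gerBl invr_ge0.
elim: n => [|n IH].
  rewrite big_nat1 /eps invr1 le_eqVlt; apply/orP; left; apply/eqP.
  by field; rewrite gt_eqF.
rewrite sum_nat1_recr.
have n0 : 0 < n.+1%:R :> R by rewrite ltr0n.
have c0 : 0 <= L ^+ 2 / sigma * D ^+ 2.
  by rewrite mulr_ge0 ?sqr_ge0 // divr_ge0 ?sqr_ge0 // ltW.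
suff : (n.+2 * n.+3)%:R * eps n.+2
    <= L ^+ 2 / sigma * D ^+ 2 * (n.+1%:R^-1 - n.+2%:R^-1).
  move: IH; move: (n.+1%:R^-1) (n.+2%:R^-1) (L ^+ 2 / sigma * D ^+ 2) => b d c.
  lra.
have -> : (n.+2 * n.+3)%:R * eps n.+2
    = L ^+ 2 / sigma * D ^+ 2 * (n.+2%:R ^+ 2)^-1.
  rewrite /eps !natrM; field.
  by rewrite !gt_eqF ?ltr0n.
rewrite ler_wpM2l //.
have -> : n.+2%:R = n.+1%:R + 1 :> R by rewrite natr1.
move: (n.+1%:R) n0 => m m0.
have -> : m^-1 - (m + 1)^-1 = (m * (m + 1))^-1.
  by field; rewrite !gt_eqF ?addr_gt0.
rewrite lef_pV2 ?posrE ?exprn_gt0 ?mulr_gt0 ?addr_gt0 // expr2 ler_wpM2r //.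
  by rewrite ltW // addr_gt0.
by rewrite lerDl.
Qed.
End Complexity.

End Saddle.

(** The gap bounds cover every run meeting its accuracies, while the oracle count concerns calls
    stopped at the first success; the existence clause shows that neither is vacuous. *)
Theorem theorem1 (R : realType) (p q : nat) (Y : set 'rV[R]_q)
    (g : 'rV[R]_p -> 'rV[R]_q -> R)
    (gx : 'rV[R]_p -> 'rV[R]_q -> 'rV[R]_p)
    (gy : 'rV[R]_p -> 'rV[R]_q -> 'rV[R]_q)
    (D L sigma : R) (x0 : 'rV[R]_p) (y0 : 'rV[R]_q)
    (hsigma : 0 < sigma) (hsigmaL : sigma <= L)
    (hYconvex : convex_set Y) (hYcompact : compact Y)
    (hD : is_max [set enorm (y - y') | y in Y & y' in Y] D)
    (hsmooth : smooth_on Y L g gx gy)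
    (hsc : forall y, Y y -> strongly_convex sigma (g^~ y))
    (hconcave : forall x, concave_on Y (g x))
    (hy0 : Y y0) :
  (forall (K : nat) (eps : nat -> R), (1 <= K)%N ->
     (forall k, (1 <= k <= K)%N -> 0 < eps k) ->
     (exists T, diag_first_run g gx gy Y D L sigma x0 y0 eps T K) /\
     (forall T, diag_run g gx gy Y D L sigma x0 y0 eps T K ->
        gap_le Y g
          (diag_xbar gx gy Y D L sigma x0 y0 eps T K)
          (diag_y gx gy Y D L sigma x0 y0 eps T K)
          ((4 * (L ^+ 2 / sigma) * D ^+ 2
            + \sum_(1 <= k < K.+1) (k * k.+1)%:R * eps k)
           / (K * K.+1)%:R))) /\
  (0 < D ->
     let eps (k : nat) : R :=
       L ^+ 2 * D ^+ 2 / (sigma * (k ^ 3 * k.+1)%:R) in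
     (forall (K : nat) T, (1 <= K)%N ->
        diag_run g gx gy Y D L sigma x0 y0 eps T K ->
        gap_le Y g
          (diag_xbar gx gy Y D L sigma x0 y0 eps T K)
          (diag_y gx gy Y D L sigma x0 y0 eps T K)
          (6 * (L ^+ 2 / sigma) * D ^+ 2 / (K * K.+1)%:R)) /\
     (forall N : nat -> nat,
        (forall K, (1 <= K)%N -> exists T,
           diag_first_run g gx gy Y D L sigma x0 y0 eps T K /\
           N K = diag_oracle_calls D L sigma eps T K) ->
        (limn_esup (fun K : nat =>
           ((N K)%:R / (Num.sqrt (L / sigma) * K%:R * ln (K%:R : R) ^+ 2))%:E)
         < +oo)%E)).
Proof.
have Ys := convex_set_segment hYconvex.
have gap K eps T : (1 <= K)%N -> (forall k, (1 <= k <= K)%N -> 0 < eps k) ->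
    diag_run g gx gy Y D L sigma x0 y0 eps T K -> _ := fun K1 heps hrun =>
  diag_gap hsigma hsigmaL Ys hYcompact hy0 hD hsmooth hsc hconcave heps hrun K1.
split.
  move=> K eps K1 heps; split; last by move=> T; exact: gap.
  exact: (diag_first_run_exists D x0 hsigma hsigmaL Ys hYcompact hy0 hsmooth hsc heps).
move=> D0 eps; have L0 : 0 < L := lt_le_trans hsigma hsigmaL.
split.
  move=> K T K1 hrun.
  have heps k : (1 <= k <= K)%N -> 0 < eps k.
    move=> /andP[k1 _]; rewrite /eps divr_gt0 ?mulr_gt0 ?exprn_gt0 //.
    by rewrite ltr0n muln_gt0 expn_gt0 k1.
  have [M [m [hM hm h]]] := gap K eps T K1 heps hrun.
  exists M, m; split => //; apply: le_trans h _.
  rewrite ler_pM2r ?invr_gt0 ?ltr0n ?muln_gt0 ?K1 //.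
  have := tolerance_sum_le D L hsigma K1.
  move: (\sum_(1 <= k < K.+1) _) => s; lra.
move=> N hN.
have [M M0 hM] :=
  diag_oracle_calls_le x0 hsigma hsigmaL Ys hYcompact hy0 hD hsmooth hsc D0.
have s0 : 0 < Num.sqrt (L / sigma) by rewrite sqrtr_gt0 divr_gt0.
have bound K : (N K)%:R / (Num.sqrt (L / sigma) * K%:R * ln (K%:R : R) ^+ 2)
    <= M / Num.sqrt (L / sigma).
  (* For K <= 1 the logarithm is 0, with [ln 0] equal to 0 by default, and division by zero makes
     the quotient 0. *)
  have [K2|K2] := leqP 2 K; last first.
    have -> : ln (K%:R : R) = 0 by case: K K2 => [|[|]] // _; rewrite ?ln1 ?ln0.
    by rewrite expr0n mulr0 invr0 mulr0 divr_ge0 // ltW.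
  have [T [hT ->]] := hN K (ltnW K2).
  have K0 : 0 < K%:R :> R by rewrite ltr0n (ltn_trans _ K2).
  have l0 : 0 < ln (K%:R : R) by rewrite ln_gt0 // ltr1n.
  rewrite ler_pdivrMr ?mulr_gt0 ?exprn_gt0 //.
  by rewrite -(mulrA (Num.sqrt _)) [leRHS]mulrA divfK ?gt_eqF //; exact: hM hT K2.
apply: (@le_lt_trans _ _ (M / Num.sqrt (L / sigma))%:E); last exact: ltry.
rewrite /limn_esup /limf_esup.
(* The bound holds for every K, so the supremum over all indices already dominates the limit
   superior. *)
apply: le_trans (ereal_inf_lbound _) _; first by exists setT => //; exact: filterT.
by apply: ge_ereal_sup => _ [K _ <-]; rewrite lee_fin.
Qed.
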